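(* Let $(M^n,g)$ be a complete, connected, non-compact Ricci-flat Riemannian manifold with $n\ge3$. Suppose the curvature operator is $\lfloor\frac{n-1}2\rfloor$-nonnegative and $|\mathrm{Rm}|\in L^Q(M)$ for some $Q>1$, where $\mathrm{Rm}$ is the Riemann curvature tensor. Then $\mathrm{Rm}\equiv0$, and hence $(M,g)$ is flat.
   Context: The curvature operator $\mathfrak R:\Lambda^2TM\to\Lambda^2TM$ is the self-adjoint operator $g(\mathfrak R(X\wedge Y),Z\wedge W)=\mathrm{Rm}(X,Y,Z,W)$, with sign convention such that it equals $K\cdot\mathrm{id}$ on a space of constant curvature $K$ ($\{e_i\wedge e_j\}_{i<j}$ being orthonormal for orthonormal $\{e_i\}$). With eigenvalues $\mu_1\le\dots\le\mu_{\binom n2}$ at each point, it is $m$-nonnegative if $\mu_1+\dots+\mu_m\ge0$ at every point. *)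

(* Defs.v *)
From HB Require Import structures.
From mathcomp Require Import all_boot all_order all_algebra.
From mathcomp Require Import all_classical all_reals all_analysis.

Set Implicit Arguments.
Unset Strict Implicit.
Unset Printing Implicit Defensive.

Import Order.TTheory GRing.Theory Num.Theory.
Import numFieldNormedType.Exports.

Local Open Scope classical_set_scope.
Local Open Scope ring_scope.

(* Smooth n-manifolds are given by atlases, and tensors by their components in
   each chart. *)

Section Calculus.
Variables (R : realType) (n : nat).

Definition pd (i : 'I_n) (f : 'rV[R]_n -> R) (x : 'rV[R]_n) : R :=
  'D_(delta_mx ord0 i) f x.

(* f is C^oo on V, for V open: all its iterated partial derivatives exist and
   are continuous at each point of V. *)
Definition smooth_on (V : set 'rV[R]_n) (f : 'rV[R]_n -> R) : Prop :=
  forall (s : seq 'I_n) (x : 'rV[R]_n), V x ->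
    {for x, continuous (foldr pd f s)} /\
    forall i, derivable (foldr pd f s) x (delta_mx ord0 i).

Definition smooth_map_on (V : set 'rV[R]_n) (F : 'rV[R]_n -> 'rV[R]_n) : Prop :=
  forall b, smooth_on V (fun x => F x ord0 b).

(* Acts on row vectors: row a is the derivative of F in the direction a. *)
Definition jacobian (F : 'rV[R]_n -> 'rV[R]_n) (x : 'rV[R]_n) : 'M[R]_n :=
  \matrix_(a, b) pd a (fun y => F y ord0 b) x.

End Calculus.

(* The integral of a nonnegative Borel function against Lebesgue measure on
   R^n, as an iterated integral (Tonelli). *)
Fixpoint lebint (R : realType) (n : nat) : ('rV[R]_n -> \bar R) -> \bar R :=
  if n is m.+1 then fun f =>
    (\int[lebesgue_measure]_(x in [set: R])
       @lebint R m (fun v => f (row_mx (const_mx x : 'rV[R]_1) v)))%E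
  else fun f => f 0.

(* G : the components g(d_i, d_j) of a metric in one coordinate system. *)
Section Curvature.
Variables (R : realType) (n : nat) (G : 'rV[R]_n -> 'M[R]_n).

(* Gamma^k_ij *)
Definition christoffel (k i j : 'I_n) (x : 'rV[R]_n) : R :=
  2^-1 * \sum_l invmx (G x) k l *
    (pd i (fun y => G y j l) x + pd j (fun y => G y i l) x
     - pd l (fun y => G y i j) x).

(* R(d_i, d_j) d_k = \sum_l (curvature i j k l) d_l, where
   R(X, Y) Z = D_X D_Y Z - D_Y D_X Z - D_[X, Y] Z. *)
Definition curvature (i j k l : 'I_n) (x : 'rV[R]_n) : R :=
  pd i (christoffel l j k) x - pd j (christoffel l i k) x
  + \sum_m (christoffel m j k x * christoffel l i m x
            - christoffel m i k x * christoffel l j m x).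

(* Rm(X, Y, Z, W) = g(R(X, Y) W, Z), so that Rm(X, Y, X, Y) is the sectional
   curvature of an orthonormal pair X, Y. *)
Definition Rm (i j k l : 'I_n) (x : 'rV[R]_n) : R :=
  \sum_m curvature i j l m x * G x m k.

(* Ric(Y, Z) is the trace of X |-> R(X, Y) Z. *)
Definition Ric (j k : 'I_n) (x : 'rV[R]_n) : R := \sum_i curvature i j k i x.

Definition norm_Rm (x : 'rV[R]_n) : R :=
  let h := invmx (G x) in
  Num.sqrt (\sum_i \sum_j \sum_k \sum_l \sum_a \sum_b \sum_c \sum_d
    h i a * h j b * h k c * h l d * Rm i j k l x * Rm a b c d x).

(* The index set of the basis d_i /\ d_j, i < j, of the bivectors. *)
Definition bivec : finType := {ij : 'I_n * 'I_n | (ij.1 < ij.2)%N}.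

Definition bi1 (r : 'I_#|bivec|) : 'I_n := (val (enum_val r)).1.
Definition bi2 (r : 'I_#|bivec|) : 'I_n := (val (enum_val r)).2.

(* The inner product of bivectors:
   g(X /\ Y, Z /\ W) = g(X, Z) g(Y, W) - g(X, W) g(Y, Z). *)
Definition gram_bivec (x : 'rV[R]_n) : 'M[R]_#|bivec| :=
  \matrix_(r, s) (G x (bi1 r) (bi1 s) * G x (bi2 r) (bi2 s)
                  - G x (bi1 r) (bi2 s) * G x (bi2 r) (bi1 s)).

Definition Rm_bivec (x : 'rV[R]_n) : 'M[R]_#|bivec| :=
  \matrix_(r, s) Rm (bi1 r) (bi2 r) (bi1 s) (bi2 s) x.

(* The matrix, acting on row vectors, of the operator RR such that
   g(RR(X /\ Y), Z /\ W) = Rm(X, Y, Z, W), i.e. the solution A of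
   A *m gram_bivec x = Rm_bivec x. *)
Definition curvature_operator (x : 'rV[R]_n) : 'M[R]_#|bivec| :=
  Rm_bivec x *m invmx (gram_bivec x).

End Curvature.

(* mu lists the eigenvalues of A, with multiplicity, in nondecreasing order. *)
Definition eigenvalues (R : realType) (N : nat) (A : 'M[R]_N) (mu : seq R) :
    Prop :=
  sorted <=%R mu /\ char_poly A = \prod_(z <- mu) ('X - z%:P).

(* A second countable Hausdorff space with a smooth atlas of charts phi i,
   with inverses psi i.  The atlas need not be maximal; chart_at picks a chart
   around each point. *)
Record manifold (R : realType) (n : nat) (M : ptopologicalType) := Manifold {
  chart : Type;
  dom : chart -> set M;
  phi : chart -> M -> 'rV[R]_n;
  psi : chart -> 'rV[R]_n -> M;
  chart_at : M -> chart;
  manifold_hausdorff : hausdorff_space M;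
  manifold_countable : @second_countable M;
  dom_open : forall i, open (dom i);
  codom_open : forall i, open (phi i @` dom i);
  phiK : forall i p, dom i p -> psi i (phi i p) = p;
  phi_continuous : forall i, {within dom i, continuous (phi i)};
  psi_continuous : forall i, {within phi i @` dom i, continuous (psi i)};
  chart_atP : forall p, dom (chart_at p) p;
  transition_smooth : forall i j,
    smooth_map_on (phi i @` (dom i `&` dom j)) (phi j \o psi i)
}.

Record metric (R : realType) (n : nat) (M : ptopologicalType)
    (A : manifold R n M) := Metric {
  gm : chart A -> 'rV[R]_n -> 'M[R]_n;
  gm_smooth : forall (i : chart A) a b,
    smooth_on (phi i @` dom i) (fun x => gm i x a b);
  gm_sym : forall (i : chart A) p, dom i p ->
    (gm i (phi i p))^T = gm i (phi i p);
  gm_pos : forall (i : chart A) p (v : 'rV[R]_n), dom i p -> v != 0 ->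
    0 < (v *m gm i (phi i p) *m v^T) ord0 ord0;
  gm_change : forall (i j : chart A) p, dom i p -> dom j p ->
    let J := jacobian (phi j \o psi i) (phi i p) in
    gm i (phi i p) = J *m gm j (phi j p) *m J^T
}.

Section Riemannian.
Variables (R : realType) (n : nat) (M : ptopologicalType).
Variables (A : manifold R n M) (g : metric A).

Definition C1_curve (c : R -> M) : Prop :=
  forall t : R, 0 <= t <= 1 ->
    {for t, continuous c} /\
    forall i : chart A, dom i (c t) ->
      (\forall s \near t, derivable (phi i \o c) s 1) /\
      {for t, continuous (derive1 (phi i \o c))}.

(* The value does not depend on the chart at c t. *)
Definition speed (c : R -> M) (t : R) : R :=
  let i := chart_at A (c t) in
  let v : 'rV[R]_n := derive1 (phi i \o c) t in
  Num.sqrt ((v *m gm g i (phi i (c t)) *m v^T) ord0 ord0).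

Definition curve_length (c : R -> M) : R :=
  \int[lebesgue_measure]_(t in `[0, 1]) speed c t.

(* p and q are joined by a piecewise C^1 curve of length l. *)
Inductive joined (p : M) : M -> R -> Prop :=
| joined_refl : joined p p 0
| joined_curve (c : R -> M) (l : R) : joined p (c 0) l -> C1_curve c ->
    joined p (c 1) (l + curve_length c).

Definition dist (p q : M) : R := inf [set l | joined p q l].

Definition complete_metric : Prop :=
  forall u : nat -> M,
    (forall e : R, 0 < e -> exists N : nat, forall j k : nat,
       (N <= j)%N -> (N <= k)%N -> dist (u j) (u k) < e) ->
    exists p : M, dist (u k) p @[k --> \oo] --> (0 : R).

Definition borel : measurableType _ := g_sigma_algebraType (@open M).

(* The Riemannian measure.  These values determine it on all Borel sets, as
   countably many charts cover M. *)
Definition riemannian_measure (vol : set borel -> \bar R) : Prop :=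
  forall (i : chart A) (B : set borel), measurable B -> B `<=` dom i ->
    vol B = lebint (fun x =>
      ((\1_(phi i @` B) x : R) * Num.sqrt (\det (gm g i x)))%:E).

Definition ricci_flat : Prop :=
  forall (i : chart A) p, dom i p -> forall a b, Ric (gm g i) a b (phi i p) = 0.

Definition curvature_m_nonneg (m : nat) : Prop :=
  forall (i : chart A) p, dom i p ->
    exists2 mu : seq R,
      eigenvalues (curvature_operator (gm g i) (phi i p)) mu &
      0 <= \sum_(z <- take m mu) z.

(* |Rm|, as a function on M; it does not depend on the charts. *)
Definition abs_Rm (p : borel) : R :=
  let i := chart_at A p in norm_Rm (gm g i) (phi i p).

Definition Rm_zero : Prop :=
  forall (i : chart A) p, dom i p ->
    forall a b c d, Rm (gm g i) a b c d (phi i p) = 0.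

(* Locally isometric to Euclidean space: near each point, g is the pullback of
   the Euclidean metric by an injective smooth map F. *)
Definition flat : Prop :=
  forall p, exists i : chart A, exists W : set 'rV[R]_n,
  exists F : 'rV[R]_n -> 'rV[R]_n,
    [/\ dom i p, [/\ open W, W (phi i p) & W `<=` phi i @` dom i],
        smooth_map_on W F, set_inj W F &
        forall x, W x -> gm g i x = jacobian F x *m (jacobian F x)^T].

End Riemannian.

(* Main.v *)
Require Import Defs.
From HB Require Import structures.
From mathcomp Require Import all_boot all_order all_algebra.
From mathcomp Require Import all_classical all_reals all_analysis.
From mathcomp Require Import ring lra.

Set Implicit Arguments.
Unset Strict Implicit.
Unset Printing Implicit Defensive.

Import Order.TTheory GRing.Theory Num.Theory.
Import numFieldNormedType.Exports.

Local Open Scope classical_set_scope.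
Local Open Scope ring_scope.

(* The trace of the curvature operator is half the scalar curvature, hence 0 for
   a Ricci-flat metric.  If moreover the sum of the m lowest eigenvalues is
   nonnegative, for some 0 < m < n(n-1)/2, then the m-th and all higher
   eigenvalues are nonnegative, and since the total vanishes, all eigenvalues
   vanish.  The curvature operator is self-adjoint, hence 0.

   For Rm = 0, flat coordinates F with derivative E solve the linear system
   D_a E = Gamma_a E, D_a F = (row a of E), which is integrable because the
   curvature and the torsion vanish.  Starting from E E^T = G at one point, the
   identity propagates because both sides solve the same linear system. *)

(** * Linear algebra *)

(** The bound n >= 3 makes m = floor((n-1)/2) positive, and it leaves an eigenvalue beyond the m
    lowest; once the tail is known to vanish, that eigenvalue bounds the head from above. The
    eigenvalues are known only as roots of the characteristic polynomial, and the matrix of the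
    operator, [Rm_bivec] times the inverse Gram matrix, is not symmetric. So nothing is
    diagonalised: Cayley-Hamilton makes the operator nilpotent, and self-adjointness for the Gram
    product, factored through [G = L L^T], excludes nonzero nilpotents. In the flat part, D_a E =
    Gamma_a E says that the components of F have zero covariant Hessian. The obstacle is regularity:
    a solution transported axis by axis has no evident derivative transverse to the last axis.
    Everything is therefore quantitative, on a cube so small that the Picard and Gronwall factors
    are at most 1/2. Smoothness comes last: E is bounded because E E^T = G, hence E and F are
    continuous, hence smooth. F is injective because its Jacobian is nearly constant. *)

Lemma cholesky (R : rcfType) n (G : 'M[R]_n) : G^T = G ->
  (forall v : 'rV_n, v != 0 -> 0 < (v *m G *m v^T) ord0 ord0) ->
  exists2 L : 'M[R]_n, L \in unitmx & G = L *m L^T.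
Proof.
elim: n G => [G _ _|n IH]; first by exists 1%:M; rewrite ?unitmx1 // [G]flatmx0 [RHS]flatmx0.
change n.+1 with (1 + n)%N => G symG posG.
pose a := ulsubmx G 0 0; pose u := ursubmx G; pose D := drsubmx G.
have Eul : ulsubmx G = a%:M by rewrite [LHS]mx11_scalar.
have Edl : dlsubmx G = u^T by rewrite -{1}symG trmx_ursub symG.
have symD : D^T = D by rewrite -{2}[D]/(drsubmx G) -symG -trmx_drsub.
have EG : G = block_mx a%:M u u^T D by rewrite -Eul -Edl submxK.
have a0 : 0 < a.
  have := posG (row_mx 1 0); rewrite EG mul_row_block tr_row_mx mul_row_col.
  rewrite !mul0mx !addr0 !mul1mx trmx0 mulmx0 addr0 trmx1 mulmx1 mxE eqxx mulr1n.
  apply; apply/eqP => /(congr1 lsubmx); rewrite row_mxKl => /matrixP/(_ 0 0).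
  by rewrite !mxE eqxx => /eqP; rewrite oner_eq0.
(* The Schur complement of the corner entry [a]; the induction hypothesis is applied to it. *)
pose D' := D - a^-1 *: (u^T *m u).
have posD' (v : 'rV_n) : v != 0 -> 0 < (v *m D' *m v^T) ord0 ord0.
  (* This [c] minimises the quadratic form of [G] over vectors with second block [v]; it annihilates
     the first block of [row_mx c v *m G], and the minimum is the form of [D'] at [v]. *)
  move=> v0; pose c := - a^-1 *: (v *m u^T).
  have := posG (row_mx c v).
  have -> : row_mx c v != 0.
    by apply: contraNneq v0 => /(congr1 rsubmx); rewrite row_mxKr linear0 => ->.
  move=> /(_ isT); suff -> : row_mx c v *m G *m (row_mx c v)^T = v *m D' *m v^T by [].
  rewrite EG mul_row_block tr_row_mx mul_row_col.
  rewrite {1}/c mul_mx_scalar scalerA mulrN divff ?gt_eqF// scaleN1r addNr mul0mx add0r.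
  by rewrite /D' /c !mulmxBr -!scalemxAl scaleNr addrC -scalemxAr mulmxA.
have symD' : D'^T = D' by rewrite /D' linearB linearZ /= trmx_mul trmxK symD.
have [L Lu LE] := IH D' symD' posD'.
pose s := Num.sqrt a.
have s0 : s != 0 by rewrite sqrtr_eq0 -ltNge.
have s2 : s * s = a by rewrite -expr2 sqr_sqrtr ?ltW.
exists (block_mx s%:M 0 (s^-1 *: u^T) L).
  rewrite unitmxE det_lblock unitrM -!unitmxE Lu andbT.
  by rewrite unitmxE det_scalar expr1 unitfE.
rewrite EG tr_block_mx mulmx_block !mul0mx !addr0 !trmx0 !mulmx0 !addr0.
rewrite tr_scalar_mx -scalar_mxM s2; congr block_mx.
- by rewrite linearZ /= trmxK mul_scalar_mx scalerA divff // scale1r.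
- by rewrite mul_mx_scalar scalerA divff // scale1r.
- rewrite -LE linearZ /= trmxK -scalemxAl -scalemxAr scalerA -invfM s2 /D'.
  by rewrite addrC subrK.
Qed.

(** * Second exterior powers of matrices *)

Section CompoundMatrix.
Variables (R : comNzRingType) (n : nat).

(** The second compound matrix: its entries are 2 by 2 minors, so it represents the map induced by
    [B] on bivectors. At [G x] it is the Gram matrix [gram_bivec G x]. *)
Definition compound2 (B : 'M[R]_n) : 'M[R]_#|bivec n| :=
  \matrix_(r, s) (B (bi1 r) (bi1 s) * B (bi2 r) (bi2 s)
                  - B (bi1 r) (bi2 s) * B (bi2 r) (bi1 s)).

Lemma bi_lt (r : 'I_#|bivec n|) : (bi1 r < bi2 r)%N.
Proof. exact: valP (enum_val r). Qed.

Lemma bi_inj (r s : 'I_#|bivec n|) : bi1 r = bi1 s -> bi2 r = bi2 s -> r = s.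
Proof.
rewrite /bi1 /bi2 => e1 e2; apply: enum_val_inj; apply: val_inj.
by rewrite [LHS]surjective_pairing [RHS]surjective_pairing e1 e2.
Qed.

Lemma sum_bivec (f : 'I_n -> 'I_n -> R) :
  \sum_(r < #|bivec n|) f (bi1 r) (bi2 r) = \sum_(i < n) \sum_(j < n | (i < j)%N) f i j.
Proof.
rewrite pair_big_dep /= -(big_enum_val (A := predT)
  (fun b : bivec n => f (val b).1 (val b).2)) /=.
rewrite [RHS](reindex_omap (val : bivec n -> _) insub) /=.
  by apply: eq_bigl => b; rewrite (valP b) valK eqxx.
by move=> p hp; rewrite insubT.
Qed.

(** Passes from sums over i < j to unrestricted double sums, where contractions are matrix products:
    off the diagonal, each unordered pair occurs in both orders. *)
Lemma sum_bivec_sym (f : 'I_n -> 'I_n -> R) : (forall i, f i i = 0) ->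
  \sum_(r < #|bivec n|) (f (bi1 r) (bi2 r) + f (bi2 r) (bi1 r)) =
  \sum_i \sum_j f i j.
Proof.
move=> f0; rewrite big_split /= sum_bivec (sum_bivec (fun i j => f j i)).
rewrite [X in _ + X](exchange_big_dep predT) //= -big_split /=.
apply: eq_bigr => i _; rewrite [RHS](bigID (fun j : 'I_n => (i < j)%N)) /=.
congr (_ + _); rewrite [RHS](bigD1 i) /=; last by rewrite ltnn.
rewrite f0 add0r; apply: eq_bigl => j.
by rewrite -leqNgt [RHS]andbC -[j == i]/(val j == val i) -ltn_neqAle.
Qed.

(** Cauchy-Binet for 2 by 2 minors. The minor of [C] in [f p q] changes sign when [p] and [q] are
    swapped, so pairing the two orders antisymmetrises the product of entries of [B] into a
    minor. *)
Lemma compound2M (B C : 'M[R]_n) :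
  compound2 (B *m C) = compound2 B *m compound2 C.
Proof.
apply/matrixP => r s; rewrite !mxE.
pose f p q := (B (bi1 r) p * B (bi2 r) q) *
  (C p (bi1 s) * C q (bi2 s) - C p (bi2 s) * C q (bi1 s)).
transitivity (\sum_p \sum_q f p q).
  rewrite !big_distrlr /= -sumrB; apply: eq_bigr => p _.
  by rewrite -sumrB; apply: eq_bigr => q _; rewrite /f; ring.
rewrite -sum_bivec_sym => [|i]; last by rewrite /f; ring.
by apply: eq_bigr => t _; rewrite !mxE /f; ring.
Qed.

Lemma compound2_1 : compound2 1%:M = 1%:M.
Proof.
apply/matrixP => r s; rewrite !mxE.
have [<-|ne] := eqVneq r s.
  have /ltn_eqF := bi_lt r; rewrite -[_ == _ :> nat]/(bi1 r == bi2 r) => ->.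
  by rewrite !eqxx mul0r subr0 mulr1.
have [e1|] := eqVneq (bi1 r) (bi1 s); have [e2|] := eqVneq (bi2 r) (bi2 s);
  rewrite ?mul0r ?mulr0 ?sub0r.
- by rewrite (bi_inj e1 e2) eqxx in ne.
- move=> _; have [e3|] := eqVneq (bi1 r) (bi2 s); last by rewrite mul0r oppr0.
  by have := bi_lt s; rewrite -e1 -e3 ltnn.
- move=> _; have [e3|] := eqVneq (bi2 r) (bi1 s); last by rewrite mulr0 oppr0.
  by have := bi_lt s; rewrite -e2 -e3 ltnn.
- move=> _ _; have [e3|] := eqVneq (bi1 r) (bi2 s); last by rewrite mul0r oppr0.
  have [e4|] := eqVneq (bi2 r) (bi1 s); last by rewrite mulr0 oppr0.
  by have := bi_lt s; rewrite -e3 -e4 ltnNge ltnW // bi_lt.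
Qed.

Lemma compound2_tr (B : 'M[R]_n) : compound2 B^T = (compound2 B)^T.
Proof. by apply/matrixP => r s; rewrite !mxE; ring. Qed.

End CompoundMatrix.

(** * Eigenvalue sums and nilpotent self-adjoint operators *)

Section Eigen.
Variable R : realType.

Lemma mulmx_tr_eq0 m n (B : 'M[R]_(m, n)) : B *m B^T = 0 -> B = 0.
Proof.
move=> /matrixP E; apply/matrixP => i j; have := E i i; rewrite !mxE => /eqP.
rewrite psumr_eq0 => [/allP/(_ j (mem_index_enum _))|k _]; last first.
  by rewrite mxE -expr2 sqr_ge0.
by rewrite mxE /= -expr2 sqrf_eq0 => /eqP.
Qed.

(* A self-adjoint operator, for the inner product with Gram matrix [C *m C^T],
   whose only eigenvalue is 0. *)
Lemma selfadjoint_nilpotent_eq0 N (S C : 'M[R]_N) : S^T = S -> C \in unitmx ->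
  char_poly (S *m invmx (C *m C^T)) = 'X^N -> S = 0.
Proof.
case: N S C => [S C _ _ _|N S C symS uC]; first by rewrite [S]flatmx0.
set P := C *m C^T; set A := S *m invmx P => chA.
have uP : P \in unitmx by rewrite unitmx_mul unitmx_tr uC.
have symP : P^T = P by rewrite trmx_mul trmxK.
have AP : A *m P = S by rewrite mulmxKV.
have APT : P *m A^T = A *m P by rewrite AP -{1}symP -trmx_mul AP symS.
have A0 : A ^+ N.+1 = 0.
  have := Cayley_Hamilton A; rewrite chA.
  by rewrite rmorphXn /= horner_mx_X.
have comm k : P *m (A ^+ k)^T = A ^+ k *m P.
  elim: k => [|k IHk]; first by rewrite expr0 trmx1 mulmx1 mul1mx.
  rewrite exprSr -mulmxE trmx_mul mulmxA APT -(mulmxA A P) IHk mulmxA.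
  by rewrite mulmxE -exprS exprSr.
(* With X = [A ^+ k *m C], the relation [comm] gives X X^T = A^k P (A^k)^T = A^k A^k P = 0, so X = 0
   by positivity, and [C] is invertible. *)
have half k : A ^+ k *m A ^+ k = 0 -> A ^+ k = 0.
  move=> h; have : (A ^+ k *m C) *m (A ^+ k *m C)^T = 0.
    by rewrite trmx_mul mulmxA -(mulmxA _ C) -/P -mulmxA comm mulmxA h mul0mx.
  by move=> /mulmx_tr_eq0 /(congr1 (mulmx^~ (invmx C))); rewrite mulmxK // mul0mx.
have A1 : A = 0.
  (* A power of 2 above the nilpotency order, so that the exponent can be halved down to 1. *)
  have [m hm] : exists m, A ^+ (2 ^ m) = 0.
    exists N.+1; have := ltn_expl N.+1 (isT : (1 < 2)%N).
    by move=> /ltnW/subnK <-; rewrite exprD A0 mulr0.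
  elim: m hm => [|m IHm]; first by rewrite expr1.
  rewrite expnS mul2n -addnn exprD => h; apply: IHm; apply: half.
  by rewrite mulmxE.
by rewrite -AP A1 mul0mx.
Qed.

Lemma sorted_take_sum_eq0 (mu : seq R) m : sorted <=%R mu ->
  (0 < m < size mu)%N -> 0 <= \sum_(z <- take m mu) z ->
  \sum_(z <- mu) z = 0 -> {in mu, forall z, z = 0}.
Proof.
move=> smu /andP[m0 msz] take0 sum0.
have mono i j : (i <= j)%N -> (j < size mu)%N -> mu`_i <= mu`_j.
  move=> ij js; apply: (sorted_leq_nth le_trans le_refl) => //; rewrite inE //.
  exact: leq_ltn_trans ij js.
have drop_ge z : z \in drop m mu -> mu`_m.-1 <= z.
  move=> /(nthP 0)[k ks <-]; rewrite nth_drop; apply: mono.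
    exact: leq_trans (leq_pred _) (leq_addr _ _).
  by move: ks; rewrite size_drop ltn_subRL.
have take_le z : z \in take m mu -> z <= mu`_m.-1.
  move=> /(nthP 0)[k]; rewrite size_take msz => km <-; rewrite nth_take //.
  by apply: mono; [rewrite -ltnS prednK | exact: leq_ltn_trans (leq_pred _) msz].
have last0 : 0 <= mu`_m.-1.
  rewrite leNgt; apply/negP => neg; move: take0; apply/negP; rewrite -ltNge.
  rewrite big_seq; apply: (@le_lt_trans _ _ (\sum_(z <- take m mu) mu`_m.-1)).
    by rewrite [leRHS]big_seq; apply: ler_sum.
  rewrite big_const_seq count_predT size_take msz iter_addr_0.
  by rewrite pmulrn_llt0.
have dropge0 z : z \in drop m mu -> 0 <= z.
  by move=> /drop_ge; exact: le_trans.
have dsum : 0 <= \sum_(z <- drop m mu) z by rewrite big_seq; apply: sumr_ge0.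
have := sum0; rewrite -{1}(cat_take_drop m mu) big_cat /= => /eqP.
rewrite paddr_eq0 // => /andP[/eqP t0 /eqP d0].
have dz z : z \in drop m mu -> z = 0.
  move=> zd; apply/eqP; move: d0 => /eqP; rewrite big_seq psumr_eq0 //.
  by move=> /allP/(_ z zd); rewrite zd.
(* Here [m < size mu] matters: the tail has an entry, it is 0, and it bounds the head from above.
   The head then consists of nonpositive numbers of sum 0. *)
have last0' : mu`_m.-1 <= 0.
  have : mu`_m \in drop m mu.
    by rewrite -[m in mu`_m]addn0 -nth_drop mem_nth // size_drop subn_gt0.
  by move=> md; have := drop_ge _ md; rewrite (dz _ md).
move=> z; rewrite -(cat_take_drop m mu) mem_cat => /orP[zt|/dz//].
have : \sum_(z <- take m mu) - z = 0 by rewrite sumrN t0 oppr0.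
move=> /eqP; rewrite big_seq psumr_eq0 => [/allP/(_ z zt)|y /take_le yl].
  by rewrite zt oppr_eq0 => /eqP.
by rewrite oppr_ge0 (le_trans yl).
Qed.

Lemma eigenvalues_size N (A : 'M[R]_N) mu : eigenvalues A mu -> size mu = N.
Proof.
move=> [_ ch]; have := size_char_poly A.
by rewrite ch size_prod_XsubC => /eqP; rewrite eqSS => /eqP.
Qed.

Lemma eigenvalues_sum N (A : 'M[R]_N) mu : eigenvalues A mu ->
  \sum_(z <- mu) z = \tr A.
Proof.
move=> ev; have sz := eigenvalues_size ev; case: ev => [_ ch].
have [N0|N0] := posnP N.
  rewrite N0 in sz; rewrite (size0nil sz) big_nil.
  by rewrite /mxtrace big1 // => -[i hi]; exfalso; rewrite N0 in hi.
have := char_poly_trace A N0; rewrite ch => /eqP.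
rewrite -{1}sz coefPn_prod_XsubC ?sz -?lt0n // => /eqP /oppr_inj ->.
by [].
Qed.

Lemma eigenvalues_char_polyXn N (A : 'M[R]_N) mu m : eigenvalues A mu ->
  (0 < m < N)%N -> 0 <= \sum_(z <- take m mu) z -> \tr A = 0 ->
  char_poly A = 'X^N.
Proof.
move=> ev mN take0 tr0; have sz := eigenvalues_size ev.
have s0 := eigenvalues_sum ev; case: ev => [smu ch].
have := sorted_take_sum_eq0 smu; rewrite sz => /(_ _ mN take0); rewrite s0 => /(_ tr0) z0.
rewrite ch big_seq (eq_bigr (fun=> 'X)) => [|z /z0 ->]; last by rewrite subr0.
by rewrite -big_seq big_const_seq count_predT sz iter_mulr_1.
Qed.

End Eigen.

(** * Differential calculus in coordinates *)

Section DirectionalDerivatives.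
Variables (R : realType) (V : normedModType R).
Implicit Types (f g : V -> R) (x v : V).

(** The two difference quotients are the same function of [h]; this transfers one-variable calculus
    to directional derivatives. *)
Lemma is_derive_line f x v (s d : R) :
  is_derive (s *: v + x) v f d <-> is_derive s 1 (fun t : R => f (t *: v + x)) d.
Proof.
have E : (fun h : R => h^-1 *: ((f \o shift (s *: v + x)) (h *: v) - f (s *: v + x)))
  = (fun h : R => h^-1 *: (((fun t : R => f (t *: v + x)) \o shift s) (h *: (1 : R))
      - f (s *: v + x))).
  apply/funext => h /=; congr (_ *: (f _ - _)).
  by rewrite addrA -scalerDl -[h *: 1]/(h * 1) mulr1.
by split=> -[d1 d2]; split; rewrite /derivable /derive in d1 d2 *;
  rewrite ?E // -?E.
Qed.

Lemma is_deriveD_fun f g x v df dg : is_derive x v f df -> is_derive x v g dg ->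
  is_derive x v (fun y => f y + g y) (df + dg).
Proof. exact: is_deriveD. Qed.

Lemma is_deriveM_fun f g x v df dg : is_derive x v f df -> is_derive x v g dg ->
  is_derive x v (fun y => f y * g y) (df * g x + f x * dg).
Proof.
move=> hf hg; apply: is_derive_eq (is_deriveM hf hg) _.
by rewrite addrC -[g x *: df]/(g x * df) mulrC.
Qed.

Lemma is_derive_sum_fun n (F : V -> 'I_n -> R) x v (dF : 'I_n -> R) :
  (forall i, is_derive x v (F^~ i) (dF i)) ->
  is_derive x v (fun y => \sum_i F y i) (\sum_i dF i).
Proof.
move=> h; have := is_derive_sum h; congr is_derive.
by apply/funext => y; rewrite fct_sumE.
Qed.

(** Entrywise, so that product and transpose rules reduce to scalar ones; the general domain serves
    both partial derivatives on row vectors and derivatives along real curves. *)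
Definition dmx m p x v (F : V -> 'M[R]_(m, p)) (D : 'M[R]_(m, p)) : Prop :=
  forall i j, is_derive x v (fun y => F y i j) (D i j).

Lemma dmxD m p x v (F G : V -> 'M[R]_(m, p)) DF DG :
  dmx x v F DF -> dmx x v G DG -> dmx x v (fun y => F y + G y) (DF + DG).
Proof.
move=> hF hG i j; rewrite mxE; have := is_deriveD_fun (hF i j) (hG i j).
by congr is_derive; apply/funext => y; rewrite mxE.
Qed.

Lemma dmxN m p x v (F : V -> 'M[R]_(m, p)) DF :
  dmx x v F DF -> dmx x v (fun y => - F y) (- DF).
Proof.
move=> hF i j; rewrite mxE; have := is_deriveN (hF i j).
by congr is_derive; apply/funext => y; rewrite mxE.
Qed.

Lemma dmxM m p q x v (F : V -> 'M[R]_(m, p)) (G : V -> 'M[R]_(p, q)) DF DG :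
  dmx x v F DF -> dmx x v G DG ->
  dmx x v (fun y => F y *m G y) (DF *m G x + F x *m DG).
Proof.
move=> hF hG i j; rewrite !mxE -big_split /=.
have := is_derive_sum_fun (fun k => is_deriveM_fun (hF i k) (hG k j)).
by congr is_derive; apply/funext => y; rewrite mxE.
Qed.

Lemma dmxT m p x v (F : V -> 'M[R]_(m, p)) DF :
  dmx x v F DF -> dmx x v (fun y => (F y)^T) DF^T.
Proof.
move=> hF i j; rewrite mxE; have := hF j i.
by congr is_derive; apply/funext => y; rewrite mxE.
Qed.

Lemma dmx_near m p x v (F G : V -> 'M[R]_(m, p)) D :
  (\near x, F x = G x) -> dmx x v F D -> dmx x v G D.
Proof.
move=> FG hF i j; apply: near_eq_is_derive (hF i j).
by apply: filterS FG => y ->.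
Qed.

End DirectionalDerivatives.

Lemma dmx_line (R : realType) (V : normedModType R) m p (F : V -> 'M[R]_(m, p))
    x v (s : R) D :
  dmx (s *: v + x) v F D <-> dmx s 1 (fun t : R => F (t *: v + x)) D.
Proof.
split=> h i j; first exact/(is_derive_line (fun y => F y i j)).
exact/(is_derive_line (fun y => F y i j))/h.
Qed.

Section MeanValue.
Variable R : realType.

Lemma is_derive_continuous (f : R -> R) (x d : R) :
  is_derive x 1 f d -> {for x, continuous f}.
Proof. by move=> [h _]; exact/differentiable_continuous/derivable1_diffP. Qed.

(** Allowing either sign of [h], and locating [t] only by its absolute value, spares later estimates
    on coordinate segments a case distinction. *)
Lemma mean_value (f df : R -> R) (h : R) :
  (forall t : R, `|t| <= `|h| -> is_derive t 1 f (df t)) ->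
  exists2 t : R, `|t| <= `|h| & f h - f 0 = h * df t.
Proof.
move=> dfh; have cont a b : (forall x, x \in `[a, b] -> `|x| <= `|h|) ->
    {within `[a, b], continuous f}.
  move=> ab; apply: continuous_in_subspaceT => x.
  by rewrite inE /= => /ab/dfh/is_derive_continuous.
have [h0|h0] := leP 0 h.
  have bnd x : x \in `[0, h]%R -> `|x| <= `|h|.
    by rewrite in_itv /= => /andP[x0 xh]; rewrite !ger0_norm.
  have D x : x \in `]0, h[%R -> is_derive x 1 f (df x).
    by move=> xh; apply: dfh; apply: bnd; exact: subset_itv_oo_cc.
  have [c hc e] := MVT_segment h0 D (cont _ _ bnd).
  by exists c; [exact: bnd | rewrite e subr0 mulrC].
have bnd x : x \in `[h, 0]%R -> `|x| <= `|h|.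
  by rewrite in_itv /= => /andP[x0 xh]; rewrite !ler0_norm ?lerN2 // ltW.
have D x : x \in `]h, 0[%R -> is_derive x 1 f (df x).
  by move=> xh; apply: dfh; apply: bnd; exact: subset_itv_oo_cc.
have [c hc e] := MVT_segment (ltW h0) D (cont _ _ bnd).
exists c; first exact: bnd.
by rewrite -opprB e sub0r mulrN opprK mulrC.
Qed.

Lemma mean_value_line (V : normedModType R) (f df : V -> R) x v (h : R) :
  (forall t : R, `|t| <= `|h| -> is_derive (t *: v + x) v f (df (t *: v + x))) ->
  exists2 t : R, `|t| <= `|h| & f (h *: v + x) - f x = h * df (t *: v + x).
Proof.
move=> hd; have [|t th e] := @mean_value (fun t => f (t *: v + x))
  (fun t => df (t *: v + x)) h.
  by move=> t /hd /is_derive_line.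
by exists t => //; rewrite -e scale0r add0r.
Qed.

End MeanValue.

(** * Smooth functions on an open set *)

Section Smooth.
Variables (R : realType) (n : nat) (V : set 'rV[R]_n).
Hypothesis openV : open V.
Implicit Types (f g : 'rV[R]_n -> R) (x : 'rV[R]_n).
Local Notation e i := (delta_mx ord0 i : 'rV[R]_n).

Lemma near_open f g x : V x -> (forall y, V y -> f y = g y) ->
  \near x, f x = g x.
Proof.
move=> Vx fg; apply: (filterS _ (open_nbhs_nbhs (conj openV Vx))).
by move=> y /fg.
Qed.

Definition regular f : Prop := forall x, V x ->
  {for x, continuous f} /\ forall i, derivable f x (e i).

Lemma regular_eq f g : (forall x, V x -> f x = g x) -> regular f -> regular g.
Proof.
move=> fg rf x Vx; have [cf df] := rf x Vx; have nfg := near_open Vx fg.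
split=> [|i]; last exact: near_eq_derivable (df i).
change (g @ x --> g x); rewrite -(fg x Vx); apply: cvg_trans cf.
exact: near_eq_cvg nfg.
Qed.

Lemma pd_eq i f g x : V x -> (forall y, V y -> f y = g y) -> pd i f x = pd i g x.
Proof. by move=> Vx fg; apply: near_eq_derive; exact: near_open fg. Qed.

(** A coinduction principle: along the word [s], each iterated derivative agrees on [V] with a
    member of [P], and agreement on the open set [V] survives differentiation. It avoids any Leibniz
    formula for iterated derivatives. *)
Lemma smooth_on_closure (P : ('rV[R]_n -> R) -> Prop) :
  (forall f, P f -> regular f) ->
  (forall f i, P f -> exists2 g, P g & forall x, V x -> pd i f x = g x) ->
  forall f, P f -> smooth_on V f.
Proof.
move=> Preg Ppd f Pf s; suff [g Pg fg] : exists2 g, P g &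
    forall x, V x -> foldr (@pd R n) f s x = g x.
  by move=> x Vx; apply: (regular_eq (f := g)) Vx; [move=> y /fg | exact: Preg].
elim: s => [|i s [h Ph fh]] /=; first by exists f.
have [g Pg hg] := Ppd h i Ph; exists g => // x Vx.
by rewrite (pd_eq i Vx fh) hg.
Qed.

Lemma smooth_on_regular f : smooth_on V f -> regular f.
Proof. by move=> sf x Vx; exact: (sf [::] x Vx). Qed.

Lemma smooth_on_pd f i : smooth_on V f -> smooth_on V (pd i f).
Proof. by move=> sf s x Vx; have := sf (rcons s i) x Vx; rewrite foldr_rcons. Qed.

Lemma smooth_on_is_derive f i x : smooth_on V f -> V x ->
  is_derive x (e i) f (pd i f x).
Proof. by move=> sf Vx; apply/derivableP/(smooth_on_regular sf Vx).2. Qed.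

(** The algebra of polynomials, with real coefficients, in the functions of [S]. *)
Inductive generated (S : ('rV[R]_n -> R) -> Prop) : ('rV[R]_n -> R) -> Prop :=
| generated_gen f : S f -> generated S f
| generated_cst c : generated S (fun=> c)
| generated_add f g : generated S f -> generated S g ->
    generated S (fun x => f x + g x)
| generated_mul f g : generated S f -> generated S g ->
    generated S (fun x => f x * g x).

Lemma regularD f g : regular f -> regular g -> regular (fun x => f x + g x).
Proof.
move=> rf rg x Vx; have [cf df] := rf x Vx; have [cg dg] := rg x Vx.
split=> [|i]; first exact: (@continuousD _ _ _ f g x).
by have [] := is_deriveD_fun (derivableP (df i)) (derivableP (dg i)).
Qed.

Lemma regularM f g : regular f -> regular g -> regular (fun x => f x * g x).
Proof.
move=> rf rg x Vx; have [cf df] := rf x Vx; have [cg dg] := rg x Vx.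
split=> [|i]; first exact: (@continuousM _ _ f g x).
by have [] := is_deriveM_fun (derivableP (df i)) (derivableP (dg i)).
Qed.

(** By the Leibniz rule the generated algebra is stable under differentiation as soon as the
    derivatives of its generators lie in it. Products, inverses and solutions of linear systems are
    all treated this way, with different generators. *)
Lemma generated_smooth_on (S : ('rV[R]_n -> R) -> Prop) :
  (forall f, S f -> regular f) ->
  (forall f i, S f ->
     exists2 g, generated S g & forall x, V x -> pd i f x = g x) ->
  forall f, generated S f -> smooth_on V f.
Proof.
move=> Sreg Spd.
have Greg f : generated S f -> regular f.
  elim=> {f} [f /Sreg //|c x _|f g _ rf _ rg|f g _ rf _ rg].
  - by split=> [|i]; [exact: cst_continuous | exact: derivable_cst].
  - exact: regularD.
  - exact: regularM.
apply: smooth_on_closure => // f i; elim=> {f} [f /(Spd _ i) //|c||].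
- exists (fun=> 0) => [|x _]; first exact: generated_cst.
  exact: derive_cst.
- move=> f g Gf [f' Gf' ff'] Gg [g' Gg' gg'].
  exists (fun x => f' x + g' x) => [|x Vx]; first exact: generated_add.
  rewrite -ff' // -gg' //.
  by have [_] := is_deriveD_fun (derivableP ((Greg f Gf x Vx).2 i))
    (derivableP ((Greg g Gg x Vx).2 i)).
- move=> f g Gf [f' Gf' ff'] Gg [g' Gg' gg'].
  exists (fun x => f' x * g x + f x * g' x) => [|x Vx].
    by apply: generated_add; exact: generated_mul.
  rewrite -ff' // -gg' //.
  by have [_] := is_deriveM_fun (derivableP ((Greg f Gf x Vx).2 i))
    (derivableP ((Greg g Gg x Vx).2 i)).
Qed.

Lemma smooth_on_generated f : generated (smooth_on V) f -> smooth_on V f.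
Proof.
apply: generated_smooth_on => {}f; first exact: smooth_on_regular.
by move=> i sf; exists (pd i f) => //; apply: generated_gen; exact: smooth_on_pd.
Qed.

Lemma smooth_on_cst c : smooth_on V (fun=> c).
Proof. exact/smooth_on_generated/generated_cst. Qed.

Lemma smooth_onD f g : smooth_on V f -> smooth_on V g ->
  smooth_on V (fun x => f x + g x).
Proof.
by move=> sf sg; apply/smooth_on_generated/generated_add; exact: generated_gen.
Qed.

Lemma smooth_onM f g : smooth_on V f -> smooth_on V g ->
  smooth_on V (fun x => f x * g x).
Proof.
by move=> sf sg; apply/smooth_on_generated/generated_mul; exact: generated_gen.
Qed.

Lemma smooth_onN f : smooth_on V f -> smooth_on V (fun x => - f x).
Proof.
move=> sf; have := smooth_onM (smooth_on_cst (- 1)) sf.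
by under eq_fun do rewrite mulN1r.
Qed.

Lemma smooth_on_sum I (r : seq I) (P : pred I) (F : I -> 'rV[R]_n -> R) :
  (forall i, smooth_on V (F i)) -> smooth_on V (fun x => \sum_(i <- r | P i) F i x).
Proof.
move=> sF; elim: r => [|i r IH].
  by under eq_fun do rewrite big_nil; exact: smooth_on_cst.
under eq_fun do rewrite big_cons.
by case: (P i); [apply: smooth_onD; [exact: sF | exact: IH] | exact: IH].
Qed.

Lemma smooth_on_prod I (r : seq I) (P : pred I) (F : I -> 'rV[R]_n -> R) :
  (forall i, smooth_on V (F i)) -> smooth_on V (fun x => \prod_(i <- r | P i) F i x).
Proof.
move=> sF; elim: r => [|i r IH].
  by under eq_fun do rewrite big_nil; exact: smooth_on_cst.
under eq_fun do rewrite big_cons.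
by case: (P i); [apply: smooth_onM; [exact: sF | exact: IH] | exact: IH].
Qed.

(** Adjoin 1/f to the smooth functions: its derivative -(1/f)(1/f) f' is a polynomial in 1/f and a
    smooth function. *)
Lemma smooth_on_inv f : smooth_on V f -> (forall x, V x -> f x != 0) ->
  smooth_on V (fun x => (f x)^-1).
Proof.
move=> sf f0; pose S h := smooth_on V h \/ h = (fun x => (f x)^-1).
have df i x : V x -> is_derive x (e i) (fun x => (f x)^-1)
    (- (f x)^-1 * (f x)^-1 * pd i f x).
  move=> Vx; have [cf] := smooth_on_regular sf Vx => /(_ i) dfi.
  split; first exact: derivableV (f0 x Vx) dfi.
  by rewrite (deriveV (f0 x Vx) dfi) expr2 invfM mulNr.
apply: (@generated_smooth_on S); last by apply: generated_gen; right.
  move=> h [/smooth_on_regular //|-> x Vx]; split=> [|i].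
    by apply: (@continuousV _ _ f x); [exact: f0 | exact: (smooth_on_regular sf Vx).1].
  by have [] := df i x Vx.
move=> h i [sh|->].
  by exists (pd i h) => //; apply: generated_gen; left; exact: smooth_on_pd.
exists (fun x => (-1) * ((f x)^-1 * ((f x)^-1 * pd i f x))).
  apply: generated_mul; first exact: generated_cst.
  apply: generated_mul; first by apply: generated_gen; right.
  apply: generated_mul; first by apply: generated_gen; right.
  by apply: generated_gen; left; exact: smooth_on_pd.
move=> x Vx; have [_] := df i x Vx; rewrite /pd => ->.
by rewrite mulN1r !mulNr mulrA.
Qed.

Definition smooth_mx m p (F : 'rV[R]_n -> 'M[R]_(m, p)) : Prop :=
  forall i j, smooth_on V (fun x => F x i j).

Lemma smooth_on_det m (F : 'rV[R]_n -> 'M[R]_m) : smooth_mx F ->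
  smooth_on V (fun x => \det (F x)).
Proof.
move=> sF; apply: smooth_on_sum => s; apply: smooth_onM; first exact: smooth_on_cst.
by apply: smooth_on_prod => i; exact: sF.
Qed.

Lemma smooth_on_ext f g : (forall x, V x -> f x = g x) -> smooth_on V f ->
  smooth_on V g.
Proof.
move=> fg sf; apply: (@smooth_on_closure (fun h => exists2 h', smooth_on V h' &
  forall x, V x -> h' x = h x)); last by exists f.
  by move=> h [h' /smooth_on_regular rh' hh']; exact: regular_eq hh' rh'.
move=> h i [h' sh' hh']; exists (pd i h') => [|x Vx].
  by exists (pd i h'); [exact: smooth_on_pd | move=> ? _].
exact/esym/pd_eq.
Qed.

(** Cramer's rule: each entry of the inverse is a cofactor divided by the determinant. *)
Lemma smooth_invmx m (F : 'rV[R]_n -> 'M[R]_m) : smooth_mx F ->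
  (forall x, V x -> F x \in unitmx) -> smooth_mx (fun x => invmx (F x)).
Proof.
move=> sF uF i j.
apply: (@smooth_on_ext (fun x => (\det (F x))^-1 * cofactor (F x) j i)).
  by move=> x /uF uFx; rewrite /invmx uFx !mxE.
apply: smooth_onM.
  apply: smooth_on_inv; first exact: smooth_on_det.
  by move=> x /uF; rewrite unitmxE unitfE.
apply: smooth_onM; first exact: smooth_on_cst.
apply: smooth_on_det => k l.
by under eq_fun do rewrite !mxE; exact: sF.
Qed.

Lemma smooth_mulmx m p q (F : 'rV[R]_n -> 'M[R]_(m, p))
    (G : 'rV[R]_n -> 'M[R]_(p, q)) : smooth_mx F -> smooth_mx G ->
  smooth_mx (fun x => F x *m G x).
Proof.
move=> sF sG i j; under eq_fun do rewrite mxE.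
by apply: smooth_on_sum => k; exact: smooth_onM.
Qed.

End Smooth.

Section Schwarz.
Variables (R : realType) (n : nat) (V : set 'rV[R]_n).
Hypothesis openV : open V.
Implicit Types (f g : 'rV[R]_n -> R) (x : 'rV[R]_n).
Local Notation e i := (delta_mx ord0 i : 'rV[R]_n).

(** The mean value theorem in direction [i] for the increment [g], then in direction [j] for
    [pd i f]. The left side is symmetric in [i] and [j], which is what [schwarz] exploits. *)
Lemma double_difference f i j x (h : R) : smooth_on V f ->
  (forall s t : R, `|s| <= `|h| -> `|t| <= `|h| -> V (t *: e j + (s *: e i + x))) ->
  exists s t : R, [/\ `|s| <= `|h|, `|t| <= `|h| &
    f (h *: e j + (h *: e i + x)) - f (h *: e i + x) - (f (h *: e j + x) - f x)
      = h * (h * pd j (pd i f) (t *: e j + (s *: e i + x)))].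
Proof.
move=> sf hV; pose g y := f (h *: e j + y) - f y.
have V0 s : `|s| <= `|h| -> V (s *: e i + x).
  by move=> sh; have := hV s 0; rewrite scale0r add0r; apply; rewrite ?normr0.
have dshift y : V (h *: e j + y) ->
    is_derive y (e i) (fun y => f (h *: e j + y)) (pd i f (h *: e j + y)).
  move=> Vy; have : is_derive (0 *: e i + (h *: e j + y)) (e i) f
      (pd i f (h *: e j + y)).
    by rewrite scale0r add0r; exact: (smooth_on_is_derive i sf).
  move=> /is_derive_line; under eq_fun do rewrite addrCA.
  move=> /(is_derive_line (fun y => f (h *: e j + y))).
  by rewrite scale0r add0r.
have [|s sh gE] := @mean_value_line R _ g
    (fun y => pd i f (h *: e j + y) - pd i f y) x (e i) h.
  move=> s sh; apply: is_deriveB; first by apply: dshift; exact: hV.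
  by apply: (smooth_on_is_derive i sf); exact: V0.
have [|t th fE] := @mean_value_line R _ (pd i f) (pd j (pd i f))
    (s *: e i + x) (e j) h.
  move=> t th; apply: (@smooth_on_is_derive _ _ V) (hV _ _ sh th).
  exact: smooth_on_pd.
by exists s, t; split => //; rewrite -fE -gE /g.
Qed.

Lemma schwarz f i j x : smooth_on V f -> V x ->
  pd j (pd i f) x = pd i (pd j f) x.
Proof.
move=> sf Vx; apply/eqP; rewrite -subr_eq0 -normr_le0.
apply/ler_addgt0Pl => eps eps0; rewrite addr0.
have cont k l : {for x, continuous (pd k (pd l f))}.
  by apply: (smooth_on_regular _ Vx).1; apply: smooth_on_pd; exact: smooth_on_pd.
have close (a b c d : R) : c = d -> `|a - c| < eps / 2 -> `|b - d| < eps / 2 ->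
    `|a - b| <= eps.
  move=> ->; rewrite !ltr_norml => /andP[? ?] /andP[? ?].
  by rewrite ler_norml; apply/andP; split; lra.
have e2 : 0 < eps / 2 by rewrite divr_gt0.
have near1 k l : \forall y \near x, `|pd k (pd l f) x - pd k (pd l f) y| < eps / 2.
  by move/cvgrPdist_lt: (cont k l) => /(_ _ e2).
have : \forall y \near x, [/\ V y,
    `|pd j (pd i f) x - pd j (pd i f) y| < eps / 2 &
    `|pd i (pd j f) x - pd i (pd j f) y| < eps / 2].
  by apply: filterS3 (open_nbhs_nbhs (conj openV Vx)) (near1 j i) (near1 i j) => y.
(* For equal directions both displacements fall on one coordinate, so 2h < r is needed; r/3 provides
   it. *)
move=> /nbhs_ballP[r /= r0 hr]; pose h := r / 3.
have h0 : 0 < h by rewrite divr_gt0.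
have inball a b (s t : R) : `|s| <= `|h| -> `|t| <= `|h| ->
    ball x r (t *: e a + (s *: e b + x)).
  move=> sh th; split=> // k l; rewrite /ball /= !mxE.
  set A := t * _; set B := s * _.
  rewrite (_ : _ - _ = - (A + B)); last by ring.
  rewrite normrN (le_lt_trans (ler_normD _ _)) // !normrM.
  rewrite (@le_lt_trans _ _ (h + h)) //; last by rewrite /h; lra.
  by rewrite (gtr0_norm h0) in sh th; apply: lerD; case: (_ && _);
    rewrite ?normr1 ?normr0 ?mulr1 ?mulr0 // ltW.
have [|s [t [sh th E1]]] := @double_difference f i j x h sf.
  by move=> s t sh th; have [] := hr _ (inball j i s t sh th).
have [|s' [t' [sh' th' E2]]] := @double_difference f j i x h sf.
  by move=> s' t' sh' th'; have [] := hr _ (inball i j s' t' sh' th').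
(* Both orders compute the same second difference; cancelling h twice equates the mixed derivatives
   at two points near [x]. *)
have E : pd j (pd i f) (t *: e j + (s *: e i + x)) =
         pd i (pd j f) (t' *: e i + (s' *: e j + x)).
  apply: (mulfI (lt0r_neq0 h0)); apply: (mulfI (lt0r_neq0 h0)).
  refine (etrans (esym E1) (etrans _ E2)).
  rewrite (addrCA (h *: e j) (h *: e i) x).
  move: (f (h *: e i + (h *: e j + x))) (f (h *: e i + x)) (f (h *: e j + x)).
  by move: (f x) => a b c d; ring.
have [_ A1 _] := hr _ (inball j i s t sh th).
have [_ _ A2] := hr _ (inball i j s' t' sh' th').
exact: close E A1 A2.
Qed.

End Schwarz.

(** * Symmetries of the curvature *)

Section MatrixEntries.
Variables (R : nzRingType) (m p : nat).
Implicit Types A B : 'M[R]_(m, p).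

Lemma addmxE A B i j : (A + B) i j = A i j + B i j.
Proof. by rewrite mxE. Qed.

Lemma oppmxE A i j : (- A) i j = - A i j.
Proof. by rewrite mxE. Qed.

Lemma trmxE A i j : A^T i j = A j i.
Proof. by rewrite mxE. Qed.

End MatrixEntries.

Section CurvatureSymmetries.
Variables (R : realType) (n : nat) (V : set 'rV[R]_n) (G : 'rV[R]_n -> 'M[R]_n).
Hypothesis openV : open V.
Hypothesis smoothG : smooth_mx V G.
Hypothesis symG : forall x, V x -> (G x)^T = G x.
Hypothesis unitG : forall x, V x -> G x \in unitmx.
Local Notation e i := (delta_mx ord0 i : 'rV[R]_n).

(* Row k holds the components of D_i d_k. *)
Definition connection (i : 'I_n) (x : 'rV[R]_n) : 'M[R]_n :=
  \matrix_(k, m) christoffel G m i k x.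

Lemma connection_entry i x k m : connection i x k m = christoffel G m i k x.
Proof. by rewrite mxE. Qed.

Definition pdmx m p (F : 'rV[R]_n -> 'M[R]_(m, p)) (i : 'I_n) (x : 'rV[R]_n) :
    'M[R]_(m, p) := \matrix_(a, b) pd i (fun y => F y a b) x.

Lemma pdmxE m p (F : 'rV[R]_n -> 'M[R]_(m, p)) i x a b :
  pdmx F i x a b = pd i (fun y => F y a b) x.
Proof. by rewrite mxE. Qed.

(** Christoffel symbols of the first kind: the upper index lowered with [G]. *)
Definition lower_christoffel (i : 'I_n) (x : 'rV[R]_n) : 'M[R]_n :=
  \matrix_(k, l) (2^-1 * (pdmx G i x k l + pdmx G k x i l - pdmx G l x i k)).

Lemma lower_christoffelE i x k l : lower_christoffel i x k l =
  2^-1 * (pdmx G i x k l + pdmx G k x i l - pdmx G l x i k).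
Proof. exact: mxE. Qed.

Lemma connectionE i x :
  connection i x = lower_christoffel i x *m (invmx (G x))^T.
Proof.
apply/matrixP => k m; rewrite connection_entry /christoffel mulr_sumr mxE.
apply: eq_bigr => l _; rewrite lower_christoffelE trmxE !pdmxE.
by rewrite -mulrA; congr (_ * _); rewrite mulrC.
Qed.

Lemma connectionG i x : V x -> connection i x *m G x = lower_christoffel i x.
Proof.
by move=> Vx; rewrite connectionE trmx_inv symG // mulmxKV // unitG.
Qed.

Lemma pdmx_sym i x : V x -> (pdmx G i x)^T = pdmx G i x.
Proof.
move=> Vx; apply/matrixP => a b; rewrite trmxE !pdmxE.
apply: (pd_eq openV i Vx) => y /symG /matrixP/(_ a b).
by rewrite trmxE.
Qed.

(** Adding the symbols of the first kind with [k] and [l] exchanged, the derivatives in directions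
    [k] and [l] cancel and the derivative in direction [i] remains. *)
Lemma metric_compatible i x : V x ->
  pdmx G i x = connection i x *m G x + G x *m (connection i x)^T.
Proof.
move=> Vx; have -> : G x *m (connection i x)^T = (connection i x *m G x)^T.
  by rewrite trmx_mul symG.
rewrite connectionG //; apply/matrixP => k l.
have /matrixP/(_ k l) := pdmx_sym i Vx; rewrite trmxE.
rewrite addmxE trmxE !lower_christoffelE.
by move: (pdmx G) => D E; rewrite -E; lra.
Qed.

Lemma smooth_mx_pdmx m p (F : 'rV[R]_n -> 'M[R]_(m, p)) i :
  smooth_mx V F -> smooth_mx V (pdmx F i).
Proof.
move=> sF a b; have := smooth_on_pd i (sF a b).
by congr smooth_on; apply/funext => x; rewrite pdmxE.
Qed.

Lemma pdmx_dmx m p (F : 'rV[R]_n -> 'M[R]_(m, p)) i x : smooth_mx V F ->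
  V x -> dmx x (e i) F (pdmx F i x).
Proof. by move=> sF Vx a b; rewrite pdmxE; exact: smooth_on_is_derive (sF a b) Vx. Qed.

Lemma dmx_pdmx m p (F : 'rV[R]_n -> 'M[R]_(m, p)) i x D :
  dmx x (e i) F D -> pdmx F i x = D.
Proof. by move=> h; apply/matrixP => a b; rewrite pdmxE; case: (h a b). Qed.

Lemma smooth_connection i : smooth_mx V (connection i).
Proof.
have sD j : smooth_mx V (pdmx G j) by exact: smooth_mx_pdmx.
have sL : smooth_mx V (lower_christoffel i).
  move=> k l; have -> : (fun x => lower_christoffel i x k l) =
      (fun x => 2^-1 * (pdmx G i x k l + pdmx G k x i l + - pdmx G l x i k)).
    by apply/funext => x; exact: lower_christoffelE.
  apply: (smooth_onM openV); first exact: smooth_on_cst.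
  apply: (smooth_onD openV); last by apply: (smooth_onN openV); exact: sD.
  by apply: (smooth_onD openV); exact: sD.
have sh : smooth_mx V (fun x => (invmx (G x))^T).
  move=> a b; have := smooth_invmx openV smoothG unitG b a.
  by congr smooth_on; apply/funext => x; rewrite mxE.
move=> a b; have := smooth_mulmx openV sL sh a b.
by congr smooth_on; apply/funext => x; rewrite connectionE.
Qed.

(** The products come in the order opposite to the usual commutator because components are stored in
    rows and matrices act from the right. *)
Definition curvature_mx i j x : 'M[R]_n :=
  pdmx (connection j) i x - pdmx (connection i) j x
  + connection j x *m connection i x - connection i x *m connection j x.

Lemma curvature_mx_entry i j k l x : curvature_mx i j x k l =
  pdmx (connection j) i x k l - pdmx (connection i) j x k l
  + (connection j x *m connection i x) k l
  - (connection i x *m connection j x) k l.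
Proof.
have entE (A B C D : 'M[R]_n) :
    (A - B + C - D) k l = A k l - B k l + C k l - D k l.
  by rewrite !addmxE !oppmxE.
exact: entE.
Qed.

Lemma curvature_mxE i j k l x : curvature_mx i j x k l = curvature G i j k l x.
Proof.
have pdE a b : pdmx (connection b) a x k l = pd a (christoffel G l b k) x.
  by rewrite pdmxE; congr pd; apply/funext => y; rewrite connection_entry.
have mulE a b : (connection b x *m connection a x) k l =
    \sum_m christoffel G m b k x * christoffel G l a m x.
  by rewrite mxE; apply: eq_bigr => m _; rewrite !connection_entry.
rewrite curvature_mx_entry /curvature sumrB addrA.
apply: f_equal2; last by apply: f_equal; exact: mulE.
apply: f_equal2; last exact: mulE.
by apply: f_equal2; [exact: pdE | apply: f_equal; exact: pdE].
Qed.

Lemma Rm_curvature_mx i j k l x : Rm G i j k l x = (curvature_mx i j x *m G x) l k.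
Proof. by rewrite mxE; apply: eq_bigr => m _; rewrite curvature_mxE. Qed.

Lemma curvature_antisym i j x : curvature_mx i j x = - curvature_mx j i x.
Proof.
by rewrite /curvature_mx !opprD !opprK [- pdmx _ _ _ + _]addrC [RHS]addrAC.
Qed.

Lemma pdmx_pdmxG i j x : V x -> pdmx (pdmx G i) j x =
  pdmx (connection i) j x *m G x + connection i x *m pdmx G j x +
  (pdmx (connection i) j x *m G x + connection i x *m pdmx G j x)^T.
Proof.
move=> Vx; apply: dmx_pdmx.
have d1 : dmx x (e j) (fun y => connection i y *m G y)
   (pdmx (connection i) j x *m G x + connection i x *m pdmx G j x).
  by apply: dmxM; apply: pdmx_dmx => //; exact: smooth_connection.
apply: dmx_near (dmxD d1 (dmxT d1)).
apply: filterS (open_nbhs_nbhs (conj openV Vx)) => y Vy.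
by rewrite metric_compatible // trmx_mul symG.
Qed.

(** [A], [B] stand for the connection in directions i, j, [C] for the j-derivative of [A], [D] for
    the i-derivative of [B], and [P = Q] says that second derivatives of the metric commute. The
    terms [A g B^T] and [B g A^T] are transposes of each other, occur on both sides and cancel. *)
Lemma curvature_cancel (A B C D g dgi dgj P Q : 'M[R]_n) : g^T = g ->
  dgi = A *m g + g *m A^T -> dgj = B *m g + g *m B^T ->
  P = C *m g + A *m dgj + (C *m g + A *m dgj)^T ->
  Q = D *m g + B *m dgi + (D *m g + B *m dgi)^T -> P = Q ->
  (D - C + B *m A - A *m B) *m g + ((D - C + B *m A - A *m B) *m g)^T = 0.
Proof.
move=> sg -> -> -> ->; rewrite !mulmxBl !mulmxDl mulNmx !mulmxDr !mulmxA.
have -> : B *m g *m A^T = (A *m g *m B^T)^T.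
  by rewrite !trmx_mul trmxK sg mulmxA.
move: (C *m g) (D *m g) (A *m B *m g) (B *m A *m g) (A *m g *m B^T).
move=> c d ab ba u E; apply/matrixP => i j.
have /matrixP/(_ i j) := E; rewrite !(addmxE, oppmxE, trmxE) mxE.
by move=> h; lra.
Qed.

Lemma curvature_mxG_antisym i j x : V x ->
  curvature_mx i j x *m G x + (curvature_mx i j x *m G x)^T = 0.
Proof.
move=> Vx.
have sch : pdmx (pdmx G j) i x = pdmx (pdmx G i) j x.
  apply/matrixP => a b.
  apply: etrans (pdmxE _ _ _ _ _) (etrans _ (esym (pdmxE _ _ _ _ _))).
  have E k : (fun y => pdmx G k y a b) = pd k (fun y => G y a b).
    by apply/funext => y; rewrite pdmxE.
  rewrite (E i) (E j).
  exact: (schwarz openV _ _ (smoothG a b) Vx).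
exact: curvature_cancel (symG Vx) (metric_compatible i Vx)
  (metric_compatible j Vx) (pdmx_pdmxG i j Vx) (pdmx_pdmxG j i Vx) (esym sch).
Qed.

Lemma Rm_antisym_r i j k l x : V x -> Rm G i j k l x = - Rm G i j l k x.
Proof.
move=> Vx; rewrite !Rm_curvature_mx; apply/eqP; rewrite -addr_eq0; apply/eqP.
by have /matrixP/(_ l k) := curvature_mxG_antisym i j Vx; rewrite addmxE trmxE [RHS]mxE.
Qed.

Lemma Rm_antisym_l i j k l x : Rm G i j k l x = - Rm G j i k l x.
Proof. by rewrite !Rm_curvature_mx curvature_antisym mulNmx oppmxE. Qed.

Lemma connection_sym i k m x : V x -> connection i x k m = connection k x i m.
Proof.
move=> Vx; rewrite !connectionE !mxE; apply: eq_bigr => l _.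
apply: f_equal2; last by [].
rewrite !lower_christoffelE; apply: f_equal2; first by [].
apply: f_equal2; first exact: addrC.
apply: f_equal; have /matrixP/(_ k i) := pdmx_sym l Vx.
by move=> S; apply: etrans S; apply: esym; exact: trmxE.
Qed.

(** Torsion freeness exchanges the direction of a connection matrix with its row index; after these
    exchanges the twelve terms cancel in pairs. *)
Lemma bianchi i j k l x : V x ->
  curvature_mx i j x k l + curvature_mx j k x i l + curvature_mx k i x j l = 0.
Proof.
move=> Vx.
have pds a b c : pdmx (connection b) a x c l = pdmx (connection c) a x b l.
  apply: etrans (pdmxE _ _ _ _ _) (etrans _ (esym (pdmxE _ _ _ _ _))).
  by apply: (pd_eq openV a Vx) => y Vy; exact: connection_sym.
have mulS a b c : (connection b x *m connection a x) c l =
    (connection c x *m connection a x) b l.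
  by rewrite !mxE; apply: eq_bigr => m _; rewrite (connection_sym b c m Vx).
have E a b c : curvature_mx a b x c l = pdmx (connection b) a x c l -
    pdmx (connection c) b x a l + (connection b x *m connection a x) c l -
    (connection c x *m connection b x) a l.
  apply: etrans (curvature_mx_entry _ _ _ _ _) _.
  apply: f_equal2; last by apply: f_equal; exact: mulS.
  apply: f_equal2; last by [].
  by apply: f_equal2; [by [] | apply: f_equal; exact: pds].
apply: etrans (f_equal2 _ (f_equal2 _ (E i j k) (E j k i)) (E k i j)) _.
have cancel (p q r s t u : R) :
    p - q + s - t + (q - r + t - u) + (r - p + u - s) = 0 by ring.
exact: cancel.
Qed.

Lemma Rm_pair_sym i j k l x : V x -> Rm G i j k l x = Rm G k l i j x.
Proof.
(* [T a b c d] is g(R(a,b)c, d): the last two slots of [Rm] are swapped to put the Bianchi identity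
   in cyclic form. *)
move=> Vx; pose T a b c d := Rm G a b d c x.
have Ta a b c d : T a b c d = - T b a c d by exact: Rm_antisym_l.
have Tb a b c d : T a b c d = - T a b d c by exact: Rm_antisym_r.
have Tc a b c d : T a b c d + T b c a d + T c a b d = 0.
  have E (a' b' c' : 'I_n) : T a' b' c' d =
      \sum_m curvature_mx a' b' x c' m * G x m d.
    by rewrite /T Rm_curvature_mx mxE.
  rewrite !E -!big_split big1 // => m _ /=.
  by rewrite -!mulrDl bianchi // mul0r.
rewrite -[LHS]/(T i j l k) -[RHS]/(T k l j i).
move: T Ta Tb Tc => T Ta Tb Tc.
(* The octahedron argument: the Bianchi sums at (i,j,l,k) and (j,l,k,i), minus those at (l,k,i,j)
   and (k,i,j,l), reduce by antisymmetry to twice the difference sought. *)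
have := Tc i j l k; have := Tc j l k i; have := Tc l k i j; have := Tc k i j l.
have := Ta i j l k; have := Ta j l k i; have := Ta l k i j; have := Ta k i j l.
have := Tb i j l k; have := Tb j l k i; have := Tb l k i j; have := Tb k i j l.
have := Ta l i j k; have := Ta k j l i; have := Ta i l k j; have := Ta j k i l.
have := Tb l i j k; have := Tb k j l i; have := Tb i l k j; have := Tb j k i l.
have := Ta l j i k; have := Ta k i j l; have := Ta k l j i; have := Tb k l i j.
have := Tb j l i k; have := Ta j l i k; have := Ta k l i j.
by lra.
Qed.

End CurvatureSymmetries.

(** The pairs (0, j) alone number n - 1, which exceeds its half. This provides the eigenvalue beyond
    the [m] lowest. *)
Lemma card_bivec_gt n m : (3 <= n)%N -> (m <= (n - 1) %/ 2)%N -> (m < #|bivec n|)%N.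
Proof.
case: n => // n n3 mle.
pose f (i : 'I_n) : bivec n.+1 :=
  exist (fun ij : 'I_n.+1 * 'I_n.+1 => (ij.1 < ij.2)%N) (ord0, lift ord0 i) isT.
have finj : injective f.
  by move=> i j /(congr1 val)/(congr1 snd)/lift_inj.
have := leq_card f finj; rewrite card_ord; apply: leq_trans.
rewrite subn1 /= in mle; apply: leq_ltn_trans mle _.
by rewrite ltn_Pdiv //; move: n3; case: (n).
Qed.

(** * The curvature operator of a Ricci-flat metric *)

Section CurvatureOperator.
Variables (R : realType) (n : nat) (V : set 'rV[R]_n) (G : 'rV[R]_n -> 'M[R]_n).
Hypothesis openV : open V.
Hypothesis smoothG : smooth_mx V G.
Hypothesis symG : forall x, V x -> (G x)^T = G x.
Hypothesis posG : forall x, V x -> forall v : 'rV[R]_n, v != 0 ->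
  0 < (v *m G x *m v^T) ord0 ord0.

Lemma posdef_unitmx x : V x -> G x \in unitmx.
Proof.
move=> Vx; have [L uL ->] := cholesky (symG Vx) (posG Vx).
by rewrite unitmx_mul unitmx_tr uL.
Qed.

Let unitG := posdef_unitmx.

Lemma gram_bivecE x : gram_bivec G x = compound2 (G x).
Proof. by []. Qed.

Lemma invmx_gram_bivec x : V x ->
  invmx (gram_bivec G x) = compound2 (invmx (G x)).
Proof.
move=> Vx; rewrite gram_bivecE.
have E : compound2 (invmx (G x)) *m compound2 (G x) = 1%:M.
  by rewrite -compound2M mulVmx ?compound2_1 // unitG.
have [_ uP] := mulmx1_unit E.
by apply: (can_inj (mulmxK uP)); rewrite mulVmx.
Qed.

(* The trace is half the scalar curvature. *)
Lemma trace_curvature_operator x : V x -> (forall j k, Ric G j k x = 0) ->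
  \tr (curvature_operator G x) = 0.
Proof.
move=> Vx ric0; rewrite /curvature_operator invmx_gram_bivec //.
set h := invmx (G x).
have hT : h^T = h by rewrite /h trmx_inv symG.
have hS a b : h a b = h b a by rewrite -{1}hT mxE.
have aR i j k l := Rm_antisym_r openV smoothG symG unitG i j k l Vx.
have aL i j k l := Rm_antisym_l G i j k l x.
(* Summed over all [i] and [j], this is the scalar curvature. *)
pose q i j := \sum_k \sum_l Rm G i j k l x * (h k i * h l j).
have qric : \sum_i \sum_j q i j = 0.
  (* The factor [G] inside [Rm] meets its inverse and removes one contraction; summing over [i] then
     leaves the Ricci tensor. *)
  have E i j : q i j = \sum_l curvature G i j l i x * h l j.
    rewrite /q exchange_big /=; apply: eq_bigr => l _.
    rewrite (eq_bigr (fun k => \sum_m curvature G i j l m x * (G x m k * h k i) * h l j)).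
      rewrite exchange_big /=.
      rewrite (eq_bigr (fun m => curvature G i j l m x * (1%:M : 'M[R]_n) m i * h l j)).
        rewrite (bigD1 i) //= mxE eqxx mulr1 big1 ?addr0 // => m mi.
        by rewrite mxE (negbTE mi) mulr0 mul0r.
      move=> m _; rewrite -mulr_suml -mulr_sumr -(mulmxV (unitG Vx)).
      by rewrite [X in _ = _ * X * _]mxE.
    by move=> k _; rewrite /Rm mulr_suml; apply: eq_bigr => m _; ring.
  under eq_bigr do under eq_bigr do rewrite E.
  rewrite exchange_big /= big1 // => j _; rewrite exchange_big /= big1 // => l _.
  by rewrite -mulr_suml -[\sum_i _]/(Ric G j l x) ric0 mul0r.
have qs i j : q j i = q i j.
  rewrite /q exchange_big /=; apply: eq_bigr => l _; apply: eq_bigr => k _.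
  by rewrite aL aR opprK; congr (_ * _); exact: mulrC.
have q0 i : q i i = 0.
  rewrite /q big1 // => k _; rewrite big1 // => l _.
  have := aL i i k l; set t := Rm _ _ _ _ _ _ => tE.
  have -> : t = 0 by lra.
  by rewrite mul0r.
(* Antisymmetry of [Rm] in its last two indices matches the minors of [h] over k < l with the full
   sum over [k] and [l]. *)
have trE : \tr (Rm_bivec G x *m compound2 h) =
    \sum_(r < #|bivec n|) q (bi1 r) (bi2 r).
  apply: eq_bigr => r _; rewrite mxE.
  pose f k l := Rm G (bi1 r) (bi2 r) k l x * (h k (bi1 r) * h l (bi2 r)).
  rewrite /q -[RHS](@sum_bivec_sym _ _ f) => [|i].
    apply: eq_bigr => s _; rewrite !mxE /f (aR _ _ (bi2 s)).
    by rewrite mulNr -mulrBr; congr (_ * (_ - _)); rewrite mulrC.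
  have := aR (bi1 r) (bi2 r) i i; rewrite /f; set t := Rm _ _ _ _ _ _ => tE.
  have -> : t = 0 by lra.
  by rewrite mul0r.
(* The symmetric [q] vanishes on the diagonal, so the full double sum counts each bivector twice. *)
have : \sum_(r < #|bivec n|) (q (bi1 r) (bi2 r) + q (bi1 r) (bi2 r)) = 0.
  apply: etrans qric; rewrite -(sum_bivec_sym q0); apply: eq_bigr => r _.
  by rewrite [q (bi2 r) _]qs.
by rewrite trE big_split /=; move: (\sum_(r < _) _) => t tE; lra.
Qed.

Lemma Rm_bivec_sym x : V x -> (Rm_bivec G x)^T = Rm_bivec G x.
Proof.
move=> Vx; apply/matrixP => r s; rewrite /Rm_bivec !mxE.
exact: (Rm_pair_sym openV smoothG symG unitG _ _ _ _ Vx).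
Qed.

Lemma Rm_bivec_eq0 x : V x -> Rm_bivec G x = 0 -> forall i j k l, Rm G i j k l x = 0.
Proof.
move=> Vx S0.
have aR i j k l := Rm_antisym_r openV smoothG symG unitG i j k l Vx.
have aL i j k l := Rm_antisym_l G i j k l x.
have lt0 (i j k l : 'I_n) : (i < j)%N -> (k < l)%N -> Rm G i j k l x = 0.
  move=> ij kl; pose r : 'I_#|bivec n| := enum_rank
    (exist (fun ab : 'I_n * 'I_n => (ab.1 < ab.2)%N) (i, j) ij : bivec n).
  pose s : 'I_#|bivec n| := enum_rank
    (exist (fun ab : 'I_n * 'I_n => (ab.1 < ab.2)%N) (k, l) kl : bivec n).
  have /matrixP/(_ r s) := S0; rewrite [RHS]mxE mxE.
  by rewrite /bi1 /bi2 /r /s !enum_rankK.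
have lt1 (i j k l : 'I_n) : (i < j)%N -> Rm G i j k l x = 0.
  move=> ij; case: (ltngtP k l) => [kl|lk|/val_inj kl].
  - exact: lt0.
  - by rewrite aR lt0 ?oppr0.
  - by have := aR i j k l; rewrite kl; move: (Rm _ _ _ _ _ _) => t tE; lra.
move=> i j k l; case: (ltngtP i j) => [ij|ji|/val_inj ij].
- exact: lt1.
- by rewrite aL lt1 ?oppr0.
- by have := aL i j k l; rewrite ij; move: (Rm _ _ _ _ _ _) => t tE; lra.
Qed.

Lemma ricci_flat_nonneg_Rm_eq0 x m mu : V x -> (forall j k, Ric G j k x = 0) ->
  (0 < m < #|bivec n|)%N -> eigenvalues (curvature_operator G x) mu ->
  0 <= \sum_(z <- take m mu) z -> forall i j k l, Rm G i j k l x = 0.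
Proof.
move=> Vx ric0 mN ev take0; apply: (Rm_bivec_eq0 Vx).
have ch := eigenvalues_char_polyXn ev mN take0 (trace_curvature_operator Vx ric0).
have [L uL GL] := cholesky (symG Vx) (posG Vx).
(* By multiplicativity, the compound of the Cholesky factor [L] of [G x] is a factor of the Gram
   matrix of bivectors. *)
apply: (@selfadjoint_nilpotent_eq0 R _ _ (compound2 L)); first exact: Rm_bivec_sym.
  have E : compound2 L *m compound2 (invmx L) = 1%:M.
    by rewrite -compound2M mulmxV ?compound2_1.
  by have [] := mulmx1_unit E.
by rewrite -compound2_tr -compound2M -GL -gram_bivecE.
Qed.

End CurvatureOperator.

(** * Linear total differential systems *)

Section MatrixNorm.
Variable R : realType.

(** The entrywise l^1 norm: submultiplicative, and a bound on entries costs only the number of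
    entries. Hence the factors [(m * p)%:R] in the smallness conditions. *)
Definition sum_norm m p (A : 'M[R]_(m, p)) : R := \sum_i \sum_j `|A i j|.

Lemma sum_norm_ge0 m p (A : 'M[R]_(m, p)) : 0 <= sum_norm A.
Proof. by apply: sumr_ge0 => i _; apply: sumr_ge0. Qed.

Lemma sum_norm_entry m p (A : 'M[R]_(m, p)) i j : `|A i j| <= sum_norm A.
Proof.
rewrite /sum_norm (bigD1 i) //= (bigD1 j) //= -addrA lerDl.
by rewrite addr_ge0 ?sumr_ge0 // => k _; apply: sumr_ge0.
Qed.

Lemma sum_normD m p (A B : 'M[R]_(m, p)) :
  sum_norm (A + B) <= sum_norm A + sum_norm B.
Proof.
rewrite /sum_norm -big_split; apply: ler_sum => i _ /=.
by rewrite -big_split; apply: ler_sum => j _ /=; rewrite mxE ler_normD.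
Qed.

Lemma sum_normZ m p k (A : 'M[R]_(m, p)) : sum_norm (k *: A) = `|k| * sum_norm A.
Proof.
rewrite /sum_norm mulr_sumr; apply: eq_bigr => i _.
by rewrite mulr_sumr; apply: eq_bigr => j _; rewrite mxE normrM.
Qed.

Lemma sum_norm0 m p : sum_norm (0 : 'M[R]_(m, p)) = 0.
Proof. by rewrite -(scale0r 0) sum_normZ normr0 mul0r. Qed.

Lemma sum_norm_eq0 m p (A : 'M[R]_(m, p)) : sum_norm A <= 0 -> A = 0.
Proof.
move=> A0; apply/matrixP => i j; rewrite mxE; apply/eqP.
by rewrite -normr_le0 (le_trans (sum_norm_entry A i j)).
Qed.

Lemma sum_normM m p q (A : 'M[R]_(m, p)) (B : 'M[R]_(p, q)) :
  sum_norm (A *m B) <= sum_norm A * sum_norm B.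
Proof.
rewrite {2}/sum_norm mulr_suml; apply: ler_sum => i _.
apply: (@le_trans _ _ (\sum_k \sum_j `|A i j| * `|B j k|)).
  apply: ler_sum => k _; rewrite mxE; apply: le_trans (ler_norm_sum _ _ _) _.
  by apply: ler_sum => j _; rewrite normrM.
rewrite exchange_big /= mulr_suml; apply: ler_sum => j _.
rewrite -mulr_sumr ler_wpM2l // /sum_norm (bigD1 j) //= lerDl.
by apply: sumr_ge0 => k _; apply: sumr_ge0.
Qed.

Lemma sum_norm_le m p (A : 'M[R]_(m, p)) c : (forall i j, `|A i j| <= c) ->
  sum_norm A <= (m * p)%:R * c.
Proof.
move=> Ac; apply: (@le_trans _ _ (\sum_(i < m) \sum_(j < p) c)).
  by apply: ler_sum => i _; apply: ler_sum.
by rewrite !sumr_const !card_ord -mulrnA mulr_natl mulnC.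
Qed.

Lemma sum_normT m p (A : 'M[R]_(m, p)) : sum_norm A^T = sum_norm A.
Proof.
rewrite /sum_norm exchange_big; apply: eq_bigr => i _.
by apply: eq_bigr => j _; rewrite mxE.
Qed.

Lemma sum_norm_continuous (T : topologicalType) m p (F : T -> 'M[R]_(m, p)) (t : T) :
  (forall i j, {for t, continuous (fun t => F t i j)}) ->
  {for t, continuous (fun t => sum_norm (F t))}.
Proof.
move=> cF; rewrite /sum_norm.
have csum N (f : 'I_N -> T -> R) : (forall i, {for t, continuous (f i)}) ->
    {for t, continuous (fun t => \sum_i f i t)}.
  move=> cf; rewrite (_ : (fun t => _) = \sum_i f i); last first.
    by apply/funext => s; rewrite fct_sumE.
  apply: (big_ind (fun g : T -> R => {for t, continuous g})); last by [].
    exact: cst_continuous.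
  by move=> g h cg ch; exact: (@continuousD _ _ _ g h t).
apply: (csum _ (fun i t => \sum_j `|F t i j|)) => i.
apply: (csum _ (fun j t => `|F t i j|)) => j.
apply: (@continuous_comp _ _ _ (fun t => F t i j) Num.norm); first exact: cF.
exact: norm_continuous.
Qed.

End MatrixNorm.

(** The little-o form of the derivative. With the quotient multiplied out, [s = 0] is harmless, so
    the punctured neighbourhood becomes a full one. *)
Lemma is_derive0P (R : realType) (f : R -> R) (d : R) :
  is_derive (0 : R) 1 f d <-> forall eps : R, 0 < eps ->
    \forall s \near (0 : R), `|f s - f 0 - s * d| <= eps * `|s|.
Proof.
pose q (h : R) := h^-1 *: ((f \o shift 0) (h *: (1 : R)) - f 0).
have qE h : h != 0 -> f h - f 0 - h * d = h * - (d - q h).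
  move=> h0; rewrite /q /= addr0 -[h *: 1]/(h * 1) mulr1.
  rewrite -[h^-1 *: _]/(h^-1 * _) opprB mulrBr mulrA divff // mul1r.
  by [].
have cvgE : q @ 0^' --> d <-> forall eps : R, 0 < eps ->
    \forall s \near (0 : R), `|f s - f 0 - s * d| <= eps * `|s|.
  split=> [/cvgrPdist_le H eps e0|H].
    have := H _ e0; rewrite near_withinE; apply: filterS => h /= Hh.
    have [->|h0] := eqVneq h 0; first by rewrite subrr mul0r subr0 normr0 mulr0.
    by rewrite qE // normrM normrN mulrC ler_wpM2r // Hh.
  apply/cvgrPdist_le => eps e0; rewrite near_withinE.
  apply: filterS (H _ e0) => h Hh h0; move: Hh.
  by rewrite qE // normrM normrN mulrC ler_pM2r // normr_gt0.
rewrite -cvgE; split=> [[df <-]|qd]; first exact: df.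
by split; [apply/cvg_ex; exists d | exact: cvg_lim qd].
Qed.

(** * Linear ordinary differential equations by Picard iteration *)

Section Primitive.
Variables (R : realType) (sigma : R).
Hypothesis sigma0 : 0 < sigma.

(* Clamping the upper bound of integration makes the Picard iterates of a
   differential equation on [-sigma, sigma] continuous on the whole line. *)
Definition clamp (t : R) : R := Num.max (- sigma) (Num.min sigma t).

Lemma clamp_le t : `|clamp t| <= sigma.
Proof.
rewrite /clamp ler_norml le_max lexx /= ge_max ge_min lexx /= andbT.
by move: sigma0; lra.
Qed.

Lemma clampE t : `|t| <= sigma -> clamp t = t.
Proof.
rewrite ler_norml /clamp => /andP[ts1 ts2].
by rewrite (min_r ts2) (max_r ts1).
Qed.

Lemma clamp_continuous : continuous clamp.
Proof.
move=> t; apply: (@continuous_max _ _ (fun=> - sigma) (fun t => Num.min sigma t)).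
  exact: cst_continuous.
apply: (@continuous_min _ _ (fun=> sigma) id); first exact: cst_continuous.
exact: cvg_id.
Qed.

(** Integration starts at [- sigma - 1] so that all of [-sigma, sigma] is interior to the domain of
    the fundamental theorem; the subtraction normalises the value at 0. *)
Definition primitive (f : R -> R) (t : R) : R :=
  \int[lebesgue_measure]_(s in `[- sigma - 1, clamp t]) f s
  - \int[lebesgue_measure]_(s in `[- sigma - 1, 0]) f s.

Lemma is_derive_integral (f : R -> R) (t : R) : continuous f -> `|t| <= sigma ->
  is_derive t 1 (fun t => \int[lebesgue_measure]_(s in `[- sigma - 1, t]) f s) (f t).
Proof.
move=> cf; rewrite ler_norml => /andP[t1 t2].
have tu : t < sigma + 1 by lra.
have fi : (@lebesgue_measure R).-integrable `[- sigma - 1, sigma + 1] (EFin \o f).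
  apply: continuous_compact_integrable; first exact: segment_compact.
  exact: continuous_subspaceT.
have ta : - sigma - 1 < t by lra.
have [d1 d2] := continuous_FTC1_closed tu fi ta (cf t).
by split; [exact: d1 | rewrite -derive1E; exact: d2].
Qed.

Lemma primitive0 f : primitive f 0 = 0.
Proof. by rewrite /primitive clampE ?subrr // normr0 ltW. Qed.

Lemma is_derive_primitive (f : R -> R) (t : R) : continuous f -> `|t| < sigma ->
  is_derive t 1 (primitive f) (f t).
Proof.
move=> cf ts.
have d1 := is_derive_integral cf (ltW ts).
have d2 := is_deriveB d1 (is_derive_cst
  (\int[lebesgue_measure]_(s in `[- sigma - 1, 0]) f s) t (1 : R)).
rewrite subr0 in d2; apply: near_eq_is_derive d2.
have : \forall s \near t, `|s| < sigma.
  apply/nbhs_ballP; exists (sigma - `|t|) => [|s]; first by rewrite /= subr_gt0.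
  rewrite /ball /= => h; have := ler_normB t (t - s).
  by rewrite opprB addrC subrK; lra.
by apply: filterS => s ss; rewrite /primitive clampE // ltW.
Qed.

Lemma primitive_continuous f : continuous f -> continuous (primitive f).
Proof.
move=> cf t; apply: (@continuousB _ _ _ (fun t => _) (fun=> _)).
  apply: (@continuous_comp _ _ _ clamp
    (fun t => \int[lebesgue_measure]_(s in `[- sigma - 1, t]) f s)).
    exact: clamp_continuous.
  exact: is_derive_continuous (is_derive_integral cf (clamp_le t)).
exact: cst_continuous.
Qed.

Lemma primitive_dist (f g : R -> R) (c t : R) : continuous f -> continuous g ->
  (forall s, `|f s - g s| <= c) -> `|primitive f t - primitive g t| <= sigma * c.
Proof.
move=> cf cg fgc.
pose F t := \int[lebesgue_measure]_(s in `[- sigma - 1, t]) f s.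
pose H t := \int[lebesgue_measure]_(s in `[- sigma - 1, t]) g s.
have [s _ E] := @mean_value R (fun t => F t - H t) (fun t => f t - g t) (clamp t)
  (fun s ss => is_deriveB
    (is_derive_integral cf (le_trans ss (clamp_le t)))
    (is_derive_integral cg (le_trans ss (clamp_le t)))).
have -> : primitive f t - primitive g t = clamp t * (f s - g s).
  by rewrite -E /primitive -/(F _) -/(H _) -/(F 0) -/(H 0); ring.
by rewrite normrM ler_pM // clamp_le.
Qed.

End Primitive.

(** [r k] is the tail of the geometric series, so the intervals of centre [u k] and radius [r k] are
    nested; the supremum of their left ends lies in all of them. *)
Lemma geometric_limit (R : realType) (u : nat -> R) (C : R) :
  (forall k, `|u k.+1 - u k| <= C * 2^-1 ^+ k) ->
  exists l, forall k, `|l - u k| <= 2 * C * 2^-1 ^+ k.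
Proof.
move=> uC; pose r k := 2 * C * 2^-1 ^+ k.
have rS k : r k = C * 2^-1 ^+ k + r k.+1.
  by rewrite /r exprS; move: (2^-1 ^+ k) => x; lra.
have r0 k : 0 <= r k.
  have := le_trans (normr_ge0 _) (uC k); rewrite /r; move: (_ ^+ k) => x.
  by rewrite -mulrA => h; rewrite mulr_ge0.
have step k : u k - r k <= u k.+1 - r k.+1 /\ u k.+1 + r k.+1 <= u k + r k.
  by have := uC k; rewrite rS ler_norml => /andP[h1 h2]; split; lra.
have lower j k : (j <= k)%N -> u j - r j <= u k - r k.
  move=> /subnK <-; elim: (k - j)%N => // d; rewrite addSn => /le_trans; apply.
  by have [] := step (d + j)%N.
have upper j k : (j <= k)%N -> u k + r k <= u j + r j.
  move=> /subnK <-; elim: (k - j)%N => // d; rewrite addSn; apply: le_trans.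
  by have [] := step (d + j)%N.
have cross j k : u j - r j <= u k + r k.
  have [jk|kj] := leqP j k.
    by apply: le_trans (lower _ _ jk) _; have := r0 k; lra.
  by apply: le_trans (upper _ _ (ltnW kj)); have := r0 j; lra.
pose S := [set u j - r j | j in [set: nat]].
have supS : has_sup S.
  split; first by exists (u 0 - r 0); exists 0.
  by exists (u 0 + r 0) => _ [j _ <-].
exists (sup S) => k; rewrite ler_distl; apply/andP; split.
  by apply: sup_upper_bound => //; exists k.
by apply: sup_le_ub; [case: supS | move=> _ [j _ <-]].
Qed.

Lemma half_pow_small (R : realType) (C eps : R) : 0 < eps ->
  exists k, C * 2^-1 ^+ k < eps.
Proof.
move=> e0; have [C0|C0] := leP C 0.
  by exists 0; rewrite expr0 mulr1 (le_lt_trans C0).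
have := @cvg_geometric R C 2^-1; rewrite ger0_norm // invf_lt1 ?ltr1n //.
move=> /(_ isT) /cvgr0Pnorm_lt /(_ _ e0) [k _ /(_ k (leqnn k))] h; exists k.
by apply: le_lt_trans (ler_norm _) h.
Qed.

Lemma eq_half_pow (R : realType) (x y C : R) :
  (forall k, `|x - y| <= C * 2^-1 ^+ k) -> x = y.
Proof.
move=> h; apply/eqP; rewrite -subr_eq0 -normr_le0; apply/ler_addgt0Pl => e e0.
have [k hk] := half_pow_small C e0; rewrite addr0.
exact: le_trans (h k) (ltW hk).
Qed.

Section LinearOde.
Variable R : realType.

Lemma uniform_limit_cont (u : nat -> R -> R) (f : R -> R) (C : R) :
  (forall k, continuous (u k)) -> (forall k t, `|f t - u k t| <= C * 2^-1 ^+ k) ->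
  continuous f.
Proof.
move=> cu fu t; apply/cvgrPdist_le => e e0.
have e3 : 0 < e / 3 by rewrite divr_gt0.
have [k hk] := half_pow_small C e3.
move/cvgrPdist_le: (cu k t) => /(_ _ e3); apply: filterS => s hs.
have h1 := fu k t; have h2 := fu k s; rewrite distrC in h2.
rewrite (_ : f t - f s = (f t - u k t) + (u k t - u k s) + (u k s - f s)); last by ring.
apply: le_trans (ler_normD _ _) _; have := ler_normD (f t - u k t) (u k t - u k s).
by lra.
Qed.

Lemma mulmx_continuous m p q (F : R -> 'M[R]_(m, p)) (G : R -> 'M[R]_(p, q)) :
  (forall i j, continuous (fun t => F t i j)) ->
  (forall i j, continuous (fun t => G t i j)) ->
  forall i j, continuous (fun t => (F t *m G t) i j).
Proof.
move=> cF cG i j t.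
rewrite (_ : (fun t => _) = \sum_k ((fun t => F t i k) * (fun t => G t k j))).
  apply: (big_ind (fun g : R -> R => {for t, continuous g})).
  - exact: cst_continuous.
  - by move=> g h cg ch; exact: (@continuousD _ _ _ g h t).
  - move=> k _; apply: (@continuousM _ _ (fun t => F t i k) (fun t => G t k j)).
      exact: cF.
    exact: cG.
by apply/funext => s; rewrite fct_sumE mxE.
Qed.

Variables (m p : nat) (sigma K : R) (B : R -> 'M[R]_m) (Y0 : 'M[R]_(m, p)).
Hypothesis sigma0 : 0 < sigma.
Hypothesis contB : forall i j, continuous (fun t => B t i j).
Hypothesis boundB : forall t, sum_norm (B t) <= K.
Hypothesis smallK : (m * p)%:R * (sigma * K) <= 2^-1.

Let K0 : 0 <= K. Proof. exact: le_trans (sum_norm_ge0 _) (boundB 0). Qed.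

Definition picard (Y : R -> 'M[R]_(m, p)) (t : R) : 'M[R]_(m, p) :=
  \matrix_(i, j) (Y0 i j + primitive sigma (fun s => (B s *m Y s) i j) t).

Lemma picard_continuous (Y : R -> 'M[R]_(m, p)) :
  (forall i j, continuous (fun t => Y t i j)) ->
  forall i j, continuous (fun t => picard Y t i j).
Proof.
move=> cY i j t.
rewrite (_ : (fun t => _) = (fun t => Y0 i j +
  primitive sigma (fun s => (B s *m Y s) i j) t)); last first.
  by apply/funext => s; rewrite mxE.
apply: (@continuousD _ _ _ (fun=> Y0 i j) _ t); first exact: cst_continuous.
apply: primitive_continuous => //; exact: mulmx_continuous.
Qed.

(** Integration contributes [sigma], the coefficient contributes [K], and passing from entries to
    the norm contributes [m * p]; [smallK] bounds the product by 1/2. *)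
Lemma picard_contraction (Y Z : R -> 'M[R]_(m, p)) (c t : R) :
  (forall i j, continuous (fun t => Y t i j)) ->
  (forall i j, continuous (fun t => Z t i j)) ->
  (forall s, sum_norm (Y s - Z s) <= c) ->
  sum_norm (picard Y t - picard Z t) <= 2^-1 * c.
Proof.
move=> cY cZ YZc; have c0 : 0 <= c by apply: le_trans (sum_norm_ge0 _) (YZc 0).
apply: (@le_trans _ _ ((m * p)%:R * (sigma * (K * c)))); last first.
  by rewrite mulrA mulrA -[X in X * c]mulrA ler_wpM2r.
apply: sum_norm_le => i j; rewrite !mxE opprD addrACA subrr add0r.
apply: primitive_dist => // [||s]; try exact: mulmx_continuous.
have -> : (B s *m Y s) i j - (B s *m Z s) i j = (B s *m (Y s - Z s)) i j.
  by rewrite mulmxBr !mxE.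
apply: le_trans (sum_norm_entry _ _ _) (le_trans (sum_normM _ _) _).
by apply: ler_pM => //; exact: sum_norm_ge0.
Qed.

Lemma linear_ode : exists Y : R -> 'M[R]_(m, p), Y 0 = Y0 /\
  forall t : R, `|t| < sigma -> dmx t 1 Y (B t *m Y t).
Proof.
pose S k := iter k picard (fun=> Y0).
have cS k i j : continuous (fun t => S k t i j).
  elim: k i j => [|k IH] i j; first by move=> t; exact: cst_continuous.
  exact: picard_continuous.
pose C := sum_norm Y0.
have dS k t : sum_norm (S k.+1 t - S k t) <= C * 2^-1 ^+ k.
  elim: k t => [|k IH] t; last first.
    have := picard_contraction t (cS k.+1) (cS k) IH.
    by rewrite exprS mulrCA.
  (* [picard] sends 0 to the constant [Y0], so the contraction estimate also bounds the first
     increment. *)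
  have -> : S 1%N t - S 0%N t = picard (fun=> Y0) t - picard (fun=> 0) t.
    congr (_ - _); apply/matrixP => i j; rewrite mxE /primitive.
    rewrite (_ : (fun s => (B s *m 0) i j) = fun=> 0); last first.
      by apply/funext => s; rewrite mulmx0 mxE.
    by rewrite /Rintegral /= !integral0 /= subrr addr0.
  rewrite expr0 mulr1; apply: (@le_trans _ _ (2^-1 * C)); last first.
    by have := sum_norm_ge0 Y0; rewrite -/C; lra.
  apply: picard_contraction; try by move=> ? ? ?; exact: cst_continuous.
  by move=> s; rewrite subr0.
have lim t i j : exists l, forall k, `|l - S k t i j| <= 2 * C * 2^-1 ^+ k.
  apply: geometric_limit => k; have := sum_norm_entry (S k.+1 t - S k t) i j.
  rewrite !mxE => /le_trans; apply; exact: dS.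
pose Y t : 'M[R]_(m, p) := \matrix_(i, j) sval (cid (lim t i j)).
have YS k t i j : `|Y t i j - S k t i j| <= 2 * C * 2^-1 ^+ k.
  by rewrite mxE; case: cid => l /= ->.
have cY i j : continuous (fun t => Y t i j).
  by apply: (uniform_limit_cont (fun k => cS k i j)) => k t; exact: YS.
have YP t : Y t = picard Y t.
  apply/matrixP => i j; apply/esym.
  (* The first summand is the contraction applied to [Y] and [S k], the second the distance from [Y]
     to [S k.+1]. *)
  apply: (@eq_half_pow _ _ _ (2^-1 * ((m * p)%:R * (2 * C)) + 2 * C)) => k.
  have h1 s : sum_norm (Y s - S k s) <= (m * p)%:R * (2 * C * 2^-1 ^+ k).
    by apply: sum_norm_le => i' j'; have := YS k s i' j'; rewrite !mxE.
  have h2 := le_trans (sum_norm_entry _ i j) (picard_contraction t cY (cS k) h1).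
  have h3 := YS k.+1 t i j.
  have h4 : 2 * C * 2^-1 ^+ k.+1 <= 2 * C * 2^-1 ^+ k.
    rewrite exprS; have : 0 <= C * 2^-1 ^+ k by rewrite mulr_ge0 ?exprn_ge0 ?sum_norm_ge0.
    by move: (_ ^+ k) => x; lra.
  rewrite addmxE oppmxE -/(S k.+1 t) in h2.
  have := ler_normB (picard Y t i j - S k.+1 t i j) (Y t i j - S k.+1 t i j).
  rewrite opprB addrA subrK; move: h2 h3 h4; rewrite -[picard (S k) t]/(S k.+1 t).
  move: (2^-1 ^+ k) (2^-1 ^+ k.+1) => x y; move: (m * p)%:R => mp.
  by move=> h2 h3 h4 h5; apply: le_trans h5 _; lra.
exists Y; split.
  by rewrite YP; apply/matrixP => i j; rewrite mxE primitive0 ?addr0.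
move=> t ts i j.
have -> : (fun t => Y t i j) =
    (fun t => Y0 i j + primitive sigma (fun s => (B s *m Y s) i j) t).
  by apply/funext => s; rewrite YP mxE.
have := is_deriveD_fun (is_derive_cst (Y0 i j) t (1 : R))
  (is_derive_primitive (@mulmx_continuous _ _ _ B Y contB cY i j) ts).
by rewrite add0r.
Qed.

End LinearOde.

Lemma gronwall (R : realType) m p (F D : R -> 'M[R]_(m, p)) (s K eps : R) :
  0 <= s -> (forall t : R, `|t| <= s -> dmx t 1 F (D t)) ->
  (forall t : R, `|t| <= s -> sum_norm (D t) <= K * sum_norm (F t) + eps) ->
  (m * p)%:R * (s * K) <= 2^-1 -> 0 <= K ->
  forall t : R, `|t| <= s ->
    sum_norm (F t) <= 2 * (sum_norm (F 0) + (m * p)%:R * (s * eps)).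
Proof.
move=> s0 dF Dle small K0.
have cont : {within `[- s, s], continuous (fun t => sum_norm (F t))}.
  apply: continuous_in_subspaceT => t; rewrite inE /= in_itv /= -ler_norml => ts.
  by apply: sum_norm_continuous => i j; exact: is_derive_continuous (dF t ts i j).
have ss : - s <= s by lra.
have [c] := EVT_max ss cont; rewrite in_itv /= -ler_norml => cs cmax t ts.
have tc : sum_norm (F t) <= sum_norm (F c).
  by apply: cmax; rewrite in_itv /= -ler_norml.
set M := sum_norm (F c) in cmax tc *.
have M0 : 0 <= M by exact: sum_norm_ge0.
have bound : sum_norm (F c - F 0) <= (m * p)%:R * (s * (K * M + eps)).
  apply: sum_norm_le => i j; rewrite addmxE oppmxE.
  have [r rc ->] := @mean_value R (fun t => F t i j) (fun t => D t i j) c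
    (fun t tc => dF t (le_trans tc cs) i j).
  have rs := le_trans rc cs; rewrite normrM; apply: ler_pM => //.
  apply: le_trans (sum_norm_entry _ i j) (le_trans (Dle r rs) _).
  by rewrite lerD2r ler_wpM2l // cmax // in_itv /= -ler_norml.
have := sum_normD (F c - F 0) (F 0); rewrite subrK -/M => h.
have : (m * p)%:R * (s * K) * M <= 2^-1 * M by rewrite ler_wpM2r.
move: bound h tc; move: (m * p)%:R (sum_norm (F 0)) (sum_norm (F t)) (sum_norm _).
by move=> mp a b d h1 h2 h3 h4; lra.
Qed.

Lemma near_forall (T : topologicalType) (I : finType) (x : T) (f : I -> set T) :
  (forall i, \forall y \near x, f i y) -> \forall y \near x, forall i, f i y.
Proof. by move=> h; exact: filter_forall. Qed.

Lemma dmxZ (R : realType) (V : normedModType R) m p (x v : V)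
    (F : V -> 'M[R]_(m, p)) DF (k : R) :
  dmx x v F DF -> dmx x v (fun y => k *: F y) (k *: DF).
Proof.
move=> hF i j; rewrite mxE; have := is_deriveM_fun (is_derive_cst k x v) (hF i j).
rewrite mul0r add0r; congr is_derive.
by apply/funext => y; rewrite mxE.
Qed.

(* Compare [U s t] with its would-be first order expansion
   [U 0 t + s (a t) (U 0 t)]: their difference solves the same linear equation
   in [t] up to an error O(s^2), by flatness. *)
Lemma parallel_commute (R : realType) m p (U : R -> R -> 'M[R]_(m, p))
    (B : R -> R -> 'M[R]_m) (B' a a' : R -> 'M[R]_m) (T delta K C : R) :
  0 < delta -> 0 <= T -> 0 <= K -> 0 <= C ->
  (m * p)%:R * (T * K) <= 2^-1 ->
  (forall s t : R, `|s| < delta -> `|t| <= T -> dmx t 1 (U s) (B s t *m U s t)) ->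
  dmx (0 : R) 1 (fun s => U s 0) (a 0 *m U 0 0) ->
  (forall t : R, `|t| <= T -> dmx t 1 a (a' t)) ->
  (forall s t : R, `|s| < delta -> `|t| <= T -> sum_norm (B s t) <= K) ->
  (forall t : R, `|t| <= T -> sum_norm (a t) <= K) ->
  (forall s t : R, `|s| < delta -> `|t| <= T ->
    sum_norm (B s t - B 0 t - s *: B' t) <= C * `|s| ^+ 2) ->
  (forall s t : R, `|s| < delta -> `|t| <= T ->
    sum_norm (B s t - B 0 t) <= C * `|s|) ->
  (forall t : R, `|t| <= T -> a' t + a t *m B 0 t = B' t + B 0 t *m a t) ->
  forall t : R, `|t| <= T -> dmx (0 : R) 1 (fun s => U s t) (a t *m U 0 t).
Proof.
move=> d0 T0 K0 C0 small dU dU0 da Bb ab B2 B1 flat t tT i j.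
have z0 : `|0 : R| < delta by rewrite normr0.
pose M := 2 * sum_norm (U 0 0).
have U0M r : `|r| <= T -> sum_norm (U 0 r) <= M.
  move=> rT; have := @gronwall R m p (U 0) (fun r => B 0 r *m U 0 r) T K 0 T0
    (fun r => dU 0 r z0) _ small K0 r rT.
  rewrite !mulr0 addr0; apply=> q qT; rewrite addr0.
  by apply: le_trans (sum_normM _ _) _; rewrite ler_wpM2r ?sum_norm_ge0 ?Bb.
have M0 : 0 <= M by rewrite mulr_ge0 ?sum_norm_ge0.
(* [C * M] comes from the second order remainder of [B], and [C * K * M] from the first order change
   of [B] applied to [a *m U]. *)
pose Q := C * M * (1 + K).
have Q0 : 0 <= Q by apply: mulr_ge0; [exact: mulr_ge0 | exact: addr_ge0].
pose F s r := U s r - U 0 r - s *: (a r *m U 0 r).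
have Fbound s r : `|s| < delta -> `|r| <= T ->
    sum_norm (F s r) <= 2 * (sum_norm (F s 0) + (m * p)%:R * (T * (Q * `|s| ^+ 2))).
  move=> sd; pose D r := B s r *m U s r - B 0 r *m U 0 r
    - s *: (a' r *m U 0 r + a r *m (B 0 r *m U 0 r)).
  apply: (@gronwall R m p (F s) D T K) => // q qT.
    apply: dmxD; last by apply: dmxN; apply: dmxZ; apply: dmxM; [exact: da | exact: dU].
    by apply: dmxD; [exact: dU | apply: dmxN; exact: dU].
  (* The hypothesis [flat] replaces [a' + a B] by [B' + B a]; beyond the homogeneous term only
     quantities of order s^2 are left. *)
  have -> : D q = B s q *m F s q + ((B s q - B 0 q - s *: B' q) *m U 0 q +
      s *: ((B s q - B 0 q) *m (a q *m U 0 q))).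
    rewrite /D /F !mulmxA -mulmxDl flat // !mulmxBr !mulmxBl mulmxDl.
    rewrite -scalemxAr -scalemxAl !mulmxA !scalerDr scalerN.
    set x1 := B s q *m U s q; set x2 := B 0 q *m U 0 q.
    set x3 := B s q *m U 0 q; set x4 := s *: (B' q *m U 0 q).
    set x5 := s *: (B s q *m a q *m U 0 q); set x6 := s *: (B 0 q *m a q *m U 0 q).
    by apply/matrixP => k l; rewrite !(addmxE, oppmxE); ring.
  apply: le_trans (sum_normD _ _) (lerD _ _).
    by apply: le_trans (sum_normM _ _) _; rewrite ler_wpM2r ?sum_norm_ge0 ?Bb.
  apply: le_trans (sum_normD _ _) _; rewrite sum_normZ.
  have e1 : sum_norm ((B s q - B 0 q - s *: B' q) *m U 0 q) <= C * `|s| ^+ 2 * M.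
    apply: le_trans (sum_normM _ _) _.
    by apply: ler_pM; rewrite ?sum_norm_ge0 ?B2 ?U0M.
  have e2 : sum_norm ((B s q - B 0 q) *m (a q *m U 0 q)) <= C * `|s| * (K * M).
    apply: le_trans (sum_normM _ _) _.
    apply: ler_pM; rewrite ?sum_norm_ge0 ?B1 //.
    apply: le_trans (sum_normM _ _) _.
    by apply: ler_pM; rewrite ?sum_norm_ge0 ?ab ?U0M.
  have e3 : `|s| * sum_norm ((B s q - B 0 q) *m (a q *m U 0 q)) <=
    `|s| * (C * `|s| * (K * M)) by rewrite ler_wpM2l.
  apply: le_trans (lerD e1 e3) _; rewrite /Q le_eqVlt; apply/orP; left.
  by apply/eqP; ring.
have FE s r k l : F s r k l = U s r k l - U 0 r k l - s * (a r *m U 0 r) k l.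
  have entE (X Y Z : 'M[R]_(m, p)) : (X - Y - s *: Z) k l = X k l - Y k l - s * Z k l.
    by rewrite !mxE.
  exact: entE.
apply/is_derive0P => eps e0.
pose mp : R := (m * p)%:R; have mp0 : 0 <= mp by exact: ler0n.
(* The Gronwall factor 2 multiplies two errors, each allotted eps/4 times |s|; the added 1 keeps the
   divisors positive. *)
pose e1 := eps / 4 / (mp + 1).
have e10 : 0 < e1 by rewrite !divr_gt0 // ltr_wpDl.
pose w := mp * (T * Q); have w0 : 0 <= w by apply: mulr_ge0 => //; exact: mulr_ge0.
pose e2 := eps / 4 / (w + 1).
have e20 : 0 < e2 by rewrite !divr_gt0 // ltr_wpDl.
have F0 : \forall s \near (0 : R), forall k l,
    `|U s 0 k l - U 0 0 k l - s * (a 0 *m U 0 0) k l| <= e1 * `|s|.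
  apply: (@near_forall R 'I_m 0 (fun k s => forall l,
    `|U s 0 k l - U 0 0 k l - s * (a 0 *m U 0 0) k l| <= e1 * `|s|)) => k.
  apply: (@near_forall R 'I_p 0 (fun l s =>
    `|U s 0 k l - U 0 0 k l - s * (a 0 *m U 0 0) k l| <= e1 * `|s|)) => l.
  by have /is_derive0P/(_ _ e10) := dU0 k l.
have near_lt d : 0 < d -> \forall s \near (0 : R), `|s| < d.
  move=> d_gt0; apply/nbhs_ballP; exists d => // s.
  by rewrite /ball /= sub0r normrN.
near=> s.
have sd : `|s| < delta by near: s; exact: near_lt.
have se2 : `|s| < e2 by near: s; exact: near_lt.
have hF0 : sum_norm (F s 0) <= mp * (e1 * `|s|).
  apply: sum_norm_le => k l; rewrite FE.
  by move: k l; near: s.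
rewrite -FE.
apply: le_trans (sum_norm_entry _ _ _) (le_trans (Fbound s t sd tT) _).
have s0 : 0 <= `|s| by [].
have k1 : mp * e1 <= eps / 4.
  rewrite /e1 mulrCA ger_pMr ?divr_gt0 // ler_pdivrMr ?ltr_wpDl // mul1r.
  by rewrite lerDl.
have k2 : w * `|s| <= eps / 4.
  apply: (@le_trans _ _ (w * e2)); first by rewrite ler_wpM2l // ltW.
  rewrite /e2 mulrCA ger_pMr ?divr_gt0 // ler_pdivrMr ?ltr_wpDl // mul1r.
  by rewrite lerDl.
have k3 := ler_wpM2r s0 k1; have k4 := ler_wpM2r s0 k2.
rewrite -/mp; have -> : mp * (T * (Q * `|s| ^+ 2)) = w * `|s| * `|s|.
  by rewrite /w; ring.
rewrite mulrA in hF0.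
move: hF0 k3 k4; move: (`|s|) (sum_norm _) => x y h1 h2 h3.
by lra.
Unshelve. all: by end_near. Qed.

(** * Integrable linear systems: the Frobenius theorem on a cube *)

Section Frobenius.
Variables (R : realType) (n m p : nat) (x0 : 'rV[R]_n).
Variables (A : 'I_n -> 'rV[R]_n -> 'M[R]_m) (rho tau K : R).
Local Notation e i := (delta_mx ord0 i : 'rV[R]_n).

Lemma ball_rowP (r : R) (x y : 'rV[R]_n) : 0 < r ->
  ball x r y <-> forall b, `|x ord0 b - y ord0 b| < r.
Proof.
move=> r0; split=> [[_ xy] b|xy]; first exact: xy.
by split=> // i j; rewrite ord1; exact: xy.
Qed.

Lemma line_entry (s : R) a b (y : 'rV[R]_n) :
  (s *: e a + y) ord0 b = s * (b == a)%:R + y ord0 b.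
Proof. by rewrite !mxE eqxx. Qed.

(** Balls of row vectors are cubes, so a move along one axis has to be checked in that coordinate
    only. *)
Lemma ball_line (r s : R) a (y : 'rV[R]_n) : 0 < r -> ball x0 r y ->
  `|x0 ord0 a - (s + y ord0 a)| < r -> ball x0 r (s *: e a + y).
Proof.
move=> r0 /(ball_rowP _ _ r0) xy h; apply/ball_rowP => // b; rewrite line_entry.
by have [->|_] := eqVneq b a; rewrite ?mulr1 // mulr0 add0r.
Qed.

Hypothesis tau0 : 0 < tau.
Hypothesis tau_rho : tau < rho.
Local Notation V := (ball x0 rho).
Hypothesis smoothA : forall a, smooth_mx V (A a).
Hypothesis boundA : forall a x, V x -> sum_norm (A a x) <= K.
Hypothesis boundA1 : forall a c x, V x -> sum_norm (pdmx (A c) a x) <= K.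
Hypothesis boundA2 : forall a c x, V x -> sum_norm (pdmx (pdmx (A c) a) a x) <= K.
Hypothesis smallK : (m * p)%:R * (tau * K) <= 2^-1.
Hypothesis flatA : forall a c x, V x ->
  pdmx (A a) c x + A a x *m A c x = pdmx (A c) a x + A c x *m A a x.

Let openV : open V. Proof. exact: ball_open. Qed.
Let rho0 : 0 < rho. Proof. exact: lt_trans tau_rho. Qed.
Let K_ge0 (a : 'I_n) : 0 <= K.
Proof. by apply: le_trans (boundA a (ballxx x0 rho0)); exact: sum_norm_ge0. Qed.

Let ball_sub x : ball x0 tau x -> V x.
Proof. by apply: le_ball; exact: ltW. Qed.

Lemma transport_exists (c : 'I_n) (y : 'rV[R]_n) (Y0 : 'M[R]_(m, p)) :
  ball x0 tau y -> y ord0 c = x0 ord0 c ->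
  exists Y : R -> 'M[R]_(m, p), Y 0 = Y0 /\
    forall t : R, `|t| < tau -> dmx t 1 Y (A c (t *: e c + y) *m Y t).
Proof.
move=> yb yc.
have lineV (t : R) : `|t| <= tau -> V (t *: e c + y).
  move=> tt; apply: ball_line => //; first exact: ball_sub.
  by rewrite yc opprD addrCA subrr addr0 normrN (le_lt_trans tt).
(* Clamping keeps the line in [V], where [A] is smooth and bounded; the closed segment fits because
   [tau < rho]. *)
pose B t := A c (clamp tau t *: e c + y).
have cB i j : continuous (fun t => B t i j).
  move=> t; apply: (@continuous_comp _ _ _ (clamp tau)
    (fun t : R => A c (t *: e c + y) i j)); first exact: clamp_continuous.
  have ct := clamp_le tau0 t.
  apply: is_derive_continuous.
  exact: (is_derive_line (fun x => A c x i j) y (e c) _ _).1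
    (smooth_on_is_derive c (smoothA c i j) (lineV _ ct)).
have bB t : sum_norm (B t) <= K by apply/boundA/lineV/clamp_le.
have [Y [Y0E dY]] := linear_ode Y0 tau0 cB bB smallK.
exists Y; split=> // t tt; have := dY t tt.
by rewrite /B clampE // ltW.
Qed.

Lemma taylor1 (f : 'rV[R]_n -> R) a (z : 'rV[R]_n) (s C : R) : smooth_on V f ->
  (forall r : R, `|r| <= `|s| -> V (r *: e a + z)) ->
  (forall x, V x -> `|pd a (pd a f) x| <= C) ->
  `|f (s *: e a + z) - f z - s * pd a f z| <= C * `|s| ^+ 2.
Proof.
move=> sf zV ddC.
have [r rs ->] := @mean_value_line R _ f (pd a f) z (e a) s
  (fun r rs => smooth_on_is_derive a sf (zV r rs)).
have [q qr E] := @mean_value_line R _ (pd a f) (pd a (pd a f)) z (e a) r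
  (fun q qr => smooth_on_is_derive a (smooth_on_pd a sf) (zV q (le_trans qr rs))).
have qC := ddC _ (zV q (le_trans qr rs)).
rewrite -mulrBr E !normrM (_ : C * _ = `|s| * (`|s| * C)); last by ring.
by rewrite ler_wpM2l // ler_pM.
Qed.

Lemma lipschitz_line (f : 'rV[R]_n -> R) a (z : 'rV[R]_n) (s C : R) :
  smooth_on V f -> (forall r : R, `|r| <= `|s| -> V (r *: e a + z)) ->
  (forall x, V x -> `|pd a f x| <= C) ->
  `|f (s *: e a + z) - f z| <= C * `|s|.
Proof.
move=> sf zV dC.
have [r rs ->] := @mean_value_line R _ f (pd a f) z (e a) s
  (fun r rs => smooth_on_is_derive a sf (zV r rs)).
by rewrite normrM mulrC ler_wpM2r //; apply: dC; exact: zV.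
Qed.

(* Induction on the number of free coordinates: the solution is transported along
   the next coordinate axis, and [parallel_commute] keeps the equations in the
   previous directions. *)
Lemma frobenius_slice (Y0 : 'M[R]_(m, p)) (k : nat) : (k <= n)%N ->
  exists E : 'rV[R]_n -> 'M[R]_(m, p), E x0 = Y0 /\
    forall x, ball x0 tau x ->
      (forall b : 'I_n, (k <= b)%N -> x ord0 b = x0 ord0 b) ->
      forall a : 'I_n, (a < k)%N -> dmx x (e a) E (A a x *m E x).
Proof.
elim: k => [_|k IH kn]; first by exists (fun=> Y0).
have [E [E0 dE]] := IH (ltnW kn); pose c := Ordinal kn.
(* Stated for every [y], with a dummy value off the slice, so that [choice] applies. *)
have ex_transport (y : 'rV[R]_n) : exists Y : R -> 'M[R]_(m, p),
    ball x0 tau y -> y ord0 c = x0 ord0 c -> Y 0 = E y /\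
    forall t : R, `|t| < tau -> dmx t 1 Y (A c (t *: e c + y) *m Y t).
  have [yb|nyb] := pselect (ball x0 tau y); last by exists (fun=> 0).
  have [yc|nyc] := pselect (y ord0 c = x0 ord0 c); last by exists (fun=> 0).
  by have [Y hY] := transport_exists (E y) yb yc; exists Y.
have [Phi PhiP] := choice ex_transport.
(* Projection along axis [c] onto the slice already solved; [E'] transports from there. *)
pose foot (x : 'rV[R]_n) := (x0 ord0 c - x ord0 c) *: e c + x.
pose E' x := Phi (foot x) (x ord0 c - x0 ord0 c).
have foot_c (x : 'rV[R]_n) : foot x ord0 c = x0 ord0 c.
  by rewrite line_entry eqxx mulr1 subrK.
have foot_ball x : ball x0 tau x -> ball x0 tau (foot x).
  by move=> xb; apply: ball_line => //; rewrite subrK subrr normr0.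
have foot_line (t : R) (y : 'rV[R]_n) : y ord0 c = x0 ord0 c -> foot (t *: e c + y) = y.
  move=> yc; apply/rowP => b; rewrite !line_entry.
  by rewrite eqxx mulr1 yc; have [->|_] := eqVneq b c; rewrite ?mulr1 ?mulr0; ring.
have E'line (t : R) (y : 'rV[R]_n) : y ord0 c = x0 ord0 c -> E' (t *: e c + y) = Phi y t.
  move=> yc; rewrite /E' foot_line // line_entry eqxx mulr1 yc.
  by congr Phi; ring.
have footK (x : 'rV[R]_n) : (x ord0 c - x0 ord0 c) *: e c + foot x = x.
  by rewrite addrA -scalerDl -[x0 ord0 c - _]opprB subrr scale0r add0r.
have x0foot : foot x0 = x0 by rewrite /foot subrr scale0r add0r.
exists E'; split.
  have [E'0 _] := PhiP x0 (ballxx x0 tau0) erefl.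
  by rewrite /E' subrr x0foot E'0.
move=> x xb xk a ak.
set y := foot x; set T := x ord0 c - x0 ord0 c.
have yb : ball x0 tau y by exact: foot_ball.
have yc : y ord0 c = x0 ord0 c by exact: foot_c.
have xE : T *: e c + y = x by exact: footK.
have Ttau : `|T| < tau.
  by move: xb => /(ball_rowP _ _ tau0)/(_ c); rewrite distrC.
have [Phi0 dPhi] := PhiP y yb yc.
(* In direction [c] the equation holds by construction of the transport; an earlier direction [a]
   needs the commutation argument, with [s] along [a] and [t] along [c]. *)
have [ac|ac] := eqVneq a c.
  rewrite ac -xE E'line //; apply/dmx_line.
  have -> : (fun t : R => E' (t *: e c + y)) = Phi y.
    by apply/funext => t; rewrite E'line.
  exact: dPhi.
have {}ak : (a < k)%N.
  by move: ak; rewrite ltnS leq_eqVlt => /orP[/eqP h|//]; case/eqP: ac; exact: val_inj.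
have yk (b : 'I_n) : (k <= b)%N -> y ord0 b = x0 ord0 b.
  rewrite leq_eqVlt => /orP[/eqP h|kb].
    by rewrite (_ : b = c) //; apply: val_inj.
  rewrite /y line_entry (_ : (b == c) = false) ?mulr0 ?add0r ?xk //.
  by apply/eqP => bc; rewrite bc /= ltnn in kb.
(* The room left in the cube around [y] in direction [a]. *)
pose delta := tau - `|x0 ord0 a - y ord0 a|.
have delta0 : 0 < delta by rewrite subr_gt0; move/(ball_rowP _ _ tau0): yb; exact.
have shift_ball (s : R) : `|s| < delta -> ball x0 tau (s *: e a + y).
  move=> sd; apply: ball_line => //.
  rewrite opprD addrCA; apply: le_lt_trans (ler_normD _ _) _.
  by rewrite normrN; move: sd; rewrite /delta; lra.
have shift_c (s : R) : (s *: e a + y) ord0 c = x0 ord0 c.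
  by rewrite line_entry eq_sym (negbTE ac) mulr0 add0r.
have lineV (s t : R) : `|s| < delta -> `|t| <= `|T| -> V (s *: e a + (t *: e c + y)).
  move=> sd tT; apply: ball_sub; rewrite addrCA; apply: ball_line => //.
    exact: shift_ball.
  by rewrite shift_c opprD addrCA subrr addr0 normrN (le_lt_trans tT).
have lineV0 (t : R) : `|t| <= `|T| -> V (t *: e c + y).
  by move=> tT; have := lineV 0 t; rewrite scale0r add0r; apply=> //; rewrite normr0.
pose B (s t : R) := A c (s *: e a + (t *: e c + y)).
have B0 t : B 0 t = A c (t *: e c + y) by rewrite /B scale0r add0r.
have entry_le q (F : 'rV[R]_n -> 'M[R]_q) i j z : sum_norm (F z) <= K -> `|F z i j| <= K.
  exact: le_trans (sum_norm_entry _ _ _).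
have pd2 i j z : V z -> `|pd a (pd a (fun z => A c z i j)) z| <= K.
  move=> Vz; have := le_trans (sum_norm_entry _ i j) (boundA2 a c Vz).
  rewrite pdmxE (_ : (fun z => pdmx (A c) a z i j) = pd a (fun z => A c z i j)) //.
  by apply/funext => w; rewrite pdmxE.
have pd1 i j z : V z -> `|pd a (fun z => A c z i j) z| <= K.
  by move=> Vz; have := le_trans (sum_norm_entry _ i j) (boundA1 a c Vz); rewrite pdmxE.
pose U (s t : R) := E' (s *: e a + (t *: e c + y)).
have UE s t : U s t = Phi (s *: e a + y) t.
  by rewrite /U addrCA E'line // shift_c.
have K0 := K_ge0 c.
have C0 : 0 <= (m * m)%:R * K by rewrite mulr_ge0.
have small : (m * p)%:R * (`|T| * K) <= 2^-1.
  apply: le_trans smallK; rewrite ler_wpM2l // ler_wpM2r //; exact: ltW.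
have := @parallel_commute R m p U B (fun t => pdmx (A c) a (t *: e c + y))
  (fun t => A a (t *: e c + y)) (fun t => pdmx (A a) c (t *: e c + y))
  `|T| delta K ((m * m)%:R * K) delta0 (normr_ge0 _) K0 C0 small.
have hU (s t : R) : `|s| < delta -> `|t| <= `|T| -> dmx t 1 (U s) (B s t *m U s t).
  move=> sd tT; have [_ dP] := PhiP _ (shift_ball s sd) (shift_c s).
  have -> : U s = Phi (s *: e a + y) by apply/funext => r; exact: UE.
  have -> : B s t = A c (t *: e c + (s *: e a + y)) by rewrite /B addrCA.
  by apply: dP; exact: le_lt_trans Ttau.
have Phi_shift (s : R) : `|s| < delta -> Phi (s *: e a + y) 0 = E (s *: e a + y).
  by move=> sd; have [] := PhiP _ (shift_ball s sd) (shift_c s).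
have n00 : `|0 : R| < delta by rewrite normr0.
have U00 : U 0 0 = E y by rewrite UE Phi_shift // scale0r add0r.
have hU0 : dmx (0 : R) 1 (fun s => U s 0) (A a (0 *: e c + y) *m U 0 0).
  apply: (@dmx_near _ _ _ _ _ _ (fun s : R => E (s *: e a + y))).
    apply/nbhs_ballP; exists delta => // s; rewrite /ball /= sub0r normrN => sd.
    by rewrite UE Phi_shift.
  rewrite U00 scale0r add0r; apply/dmx_line.
  by rewrite scale0r add0r; exact: dE.
have hA (t : R) : `|t| <= `|T| -> dmx t 1 (fun t => A a (t *: e c + y))
    (pdmx (A a) c (t *: e c + y)).
  by move=> tT; apply/dmx_line; apply: pdmx_dmx; [exact: smoothA | exact: lineV0].
move=> /(_ hU hU0 hA) comm.
have /comm {}comm : forall s t : R, `|s| < delta -> `|t| <= `|T| ->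
    sum_norm (B s t) <= K.
  by move=> s t sd tT; apply: boundA; exact: lineV.
have /comm {}comm : forall t : R, `|t| <= `|T| -> sum_norm (A a (t *: e c + y)) <= K.
  by move=> t tT; apply: boundA; exact: lineV0.
have segV (s t r : R) : `|s| < delta -> `|t| <= `|T| -> `|r| <= `|s| ->
    V (r *: e a + (t *: e c + y)).
  by move=> sd tT rs; apply: lineV => //; exact: le_lt_trans sd.
have /comm {}comm : forall s t : R, `|s| < delta -> `|t| <= `|T| ->
    sum_norm (B s t - B 0 t - s *: pdmx (A c) a (t *: e c + y))
      <= (m * m)%:R * K * `|s| ^+ 2.
  move=> s t sd tT; rewrite -mulrA; apply: sum_norm_le => i j.
  have entE (X Y Z : 'M[R]_m) : (X - Y - s *: Z) i j = X i j - Y i j - s * Z i j.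
    by rewrite !mxE.
  rewrite entE pdmxE B0 /B.
  apply: (@taylor1 (fun x => A c x i j)); first exact: smoothA.
    by move=> r rs; exact: segV rs.
  by move=> z; exact: pd2.
have /comm {}comm : forall s t : R, `|s| < delta -> `|t| <= `|T| ->
    sum_norm (B s t - B 0 t) <= (m * m)%:R * K * `|s|.
  move=> s t sd tT; rewrite -mulrA; apply: sum_norm_le => i j.
  rewrite addmxE oppmxE B0 /B.
  apply: (@lipschitz_line (fun x => A c x i j)); first exact: smoothA.
    by move=> r rs; exact: segV rs.
  by move=> z; exact: pd1.
have /comm {}comm : forall t : R, `|t| <= `|T| ->
    pdmx (A a) c (t *: e c + y) + A a (t *: e c + y) *m B 0 t =
    pdmx (A c) a (t *: e c + y) + B 0 t *m A a (t *: e c + y).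
  by move=> t tT; rewrite B0; apply: flatA; exact: lineV0.
have := comm T (lexx _); rewrite xE => d0.
have -> : E' x = U 0 T by rewrite /U scale0r add0r xE.
have := (@dmx_line R _ m p E' x (e a) 0 (A a x *m U 0 T)).2.
rewrite scale0r add0r; apply.
by have -> : (fun t : R => E' (t *: e a + x)) = (fun s => U s T);
  [apply/funext => s; rewrite /U xE | exact: d0].
Qed.

Lemma frobenius (Y0 : 'M[R]_(m, p)) :
  exists E : 'rV[R]_n -> 'M[R]_(m, p), E x0 = Y0 /\
    forall x, ball x0 tau x -> forall a, dmx x (e a) E (A a x *m E x).
Proof.
have [E [E0 dE]] := frobenius_slice Y0 (leqnn n); exists E; split=> // x xb a.
by apply: dE => // b; rewrite leqNgt ltn_ord.
Qed.

End Frobenius.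

Section BallCalculus.
Variables (R : realType) (n : nat).
Local Notation e i := (delta_mx ord0 i : 'rV[R]_n).

(** Coordinates change from [x] to [y] one at a time, so only partial derivatives are needed; the
    price is a separate intermediate point for each coordinate. *)
Lemma telescoping_mean_value (f : 'rV[R]_n -> R) (df : 'I_n -> 'rV[R]_n -> R)
    (x y : 'rV[R]_n) :
  (forall z : 'rV[R]_n, (forall b, `|z ord0 b - x ord0 b| <= `|y ord0 b - x ord0 b|) ->
     forall a, is_derive z (e a) f (df a z)) ->
  exists xi : 'I_n -> 'rV[R]_n,
    (forall c b, `|xi c ord0 b - x ord0 b| <= `|y ord0 b - x ord0 b|) /\
    f y - f x = \sum_c (y ord0 c - x ord0 c) * df c (xi c).
Proof.
move=> dfz; pose z (k : nat) : 'rV[R]_n :=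
  \row_b (if (b < k)%N then y ord0 b else x ord0 b).
have z0 : z 0 = x by apply/rowP => b; rewrite mxE.
have zn : z n = y by apply/rowP => b; rewrite mxE ltn_ord.
have zS (c : 'I_n) : z c.+1 = (y ord0 c - x ord0 c) *: e c + z c.
  apply/rowP => b; rewrite line_entry !mxE ltnS leq_eqVlt -[_ == _ :> nat]/(b == c).
  have [->|_] := eqVneq b c; last by rewrite mulr0 add0r.
  by rewrite ltnn mulr1 subrK.
have step (c : 'I_n) : exists xi : 'rV[R]_n,
    (forall b, `|xi ord0 b - x ord0 b| <= `|y ord0 b - x ord0 b|) /\
    f (z c.+1) - f (z c) = (y ord0 c - x ord0 c) * df c xi.
  have bnd (t : R) : `|t| <= `|y ord0 c - x ord0 c| -> forall b,
      `|(t *: e c + z c) ord0 b - x ord0 b| <= `|y ord0 b - x ord0 b|.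
    move=> tle b; rewrite line_entry mxE.
    have [->|_] := eqVneq b c; first by rewrite ltnn mulr1 addrK.
    by rewrite mulr0 add0r; case: ifP => _ //; rewrite subrr normr0.
  have [t tle E] := @mean_value_line R _ f (df c) (z c) (e c)
    (y ord0 c - x ord0 c) (fun t tle => dfz _ (bnd t tle) c).
  by exists (t *: e c + z c); split; [exact: bnd | rewrite zS].
have [xi xiP] := choice step; exists xi; split=> [c|]; first by have [] := xiP c.
rewrite -{1}zn -{1}z0 -(telescope_sumr (fun k => f (z k)) (leq0n n)) big_mkord.
by apply: eq_bigr => c _; have [_ ->] := xiP c.
Qed.

(** In each coordinate, [z] is within |x - x0| + |y - x| of the centre, hence within 2|x - x0| + |y
    - x0| < 3 (r/3). *)
Lemma ball_between (r : R) (x0 x y z : 'rV[R]_n) : 0 < r ->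
  ball x0 (r / 3) x -> ball x0 (r / 3) y ->
  (forall b, `|z ord0 b - x ord0 b| <= `|y ord0 b - x ord0 b|) -> ball x0 r z.
Proof.
move=> r0; have r3 : 0 < r / 3 by rewrite divr_gt0.
move=> /(ball_rowP _ _ r3) hx /(ball_rowP _ _ r3) hy hz; apply/(ball_rowP _ _ r0) => b.
have := hx b; have := hy b; have := hz b.
set p := x ord0 b; set q := y ord0 b; set s := z ord0 b; set o := x0 ord0 b.
move=> h1 h2 h3.
have k1 := ler_normD (o - p) (p - s); have k2 := ler_normD (q - o) (o - p).
have k3 := distrC s p; have k4 := distrC q o.
have E1 : o - p + (p - s) = o - s by ring.
have E2 : q - o + (o - p) = q - p by ring.
rewrite E1 in k1; rewrite E2 in k2.
have : `|o - s| <= `|o - p| + `|q - p| by rewrite -k3 in k1; lra.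
by rewrite k4 in k2; lra.
Qed.

(** Partial derivatives alone do not give continuity in several variables; bounded ones give, by
    telescoping, a Lipschitz estimate at the centre. *)
Lemma bounded_partials_continuous (f : 'rV[R]_n -> R)
    (df : 'I_n -> 'rV[R]_n -> R) (x0 : 'rV[R]_n) (r C : R) : 0 < r ->
  (forall x, ball x0 r x -> forall a, is_derive x (e a) f (df a x)) ->
  (forall x, ball x0 r x -> forall a, `|df a x| <= C) ->
  {for x0, continuous f}.
Proof.
move=> r0 dfx dfC; suff : f @ nbhs x0 --> f x0 by [].
apply/cvgrPdist_le => eps e0.
have C0 (a : 'I_n) : 0 <= C by apply: le_trans (dfC x0 (ballxx x0 r0) a).
have r3 : 0 < r / 3 by rewrite divr_gt0.
pose D := n%:R * `|C| + 1; have D0 : 0 < D by rewrite ltr_wpDl // mulr_ge0.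
have [d [d0 dr dD]] : exists d, [/\ 0 < d, d <= r / 3 & D * d <= eps].
  exists (Num.min (r / 3) (eps / D)); split; first by rewrite lt_min r3 divr_gt0.
    by rewrite ge_min lexx.
  rewrite mulrC -ler_pdivlMr // ge_min lexx orbT //.
apply/nbhs_ballP; exists d => // y yd.
have [xi [xb E]] := @telescoping_mean_value f df x0 y (fun z zb =>
  dfx z (ball_between r0 (ballxx x0 r3) (le_ball dr yd) zb)).
rewrite -normrN opprB E; apply: le_trans (ler_norm_sum _ _ _) _.
apply: le_trans dD; apply: (@le_trans _ _ (\sum_(c < n) d * `|C|)).
  apply: ler_sum => c _; rewrite normrM; apply: ler_pM => //.
    by move/(ball_rowP _ _ d0): yd => /(_ c) /ltW; rewrite distrC.
  apply: le_trans (ler_norm C); apply: dfC.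
  exact: ball_between r0 (ballxx x0 r3) (le_ball dr yd) (xb c).
rewrite sumr_const card_ord -[leLHS]mulr_natl /D mulrDl mul1r.
by rewrite (_ : n%:R * (d * `|C|) = n%:R * `|C| * d); [rewrite lerDl ltW | ring].
Qed.

(** Uniqueness for total differential systems: zero spreads from the centre one axis at a time, by
    [gronwall] with zero initial value and zero error. *)
Lemma zero_of_linear_bound m p (Z : 'rV[R]_n -> 'M[R]_(m, p))
    (D : 'I_n -> 'rV[R]_n -> 'M[R]_(m, p)) (x0 : 'rV[R]_n) (tau K : R) :
  0 < tau -> 0 <= K -> (m * p)%:R * (tau * K) <= 2^-1 ->
  (forall x, ball x0 tau x -> forall a, dmx x (e a) Z (D a x)) ->
  (forall x, ball x0 tau x -> forall a, sum_norm (D a x) <= K * sum_norm (Z x)) ->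
  Z x0 = 0 -> forall x, ball x0 tau x -> Z x = 0.
Proof.
move=> tau0 K0 small dZ Dle Z0.
suff slice (k : nat) x : ball x0 tau x ->
    (forall b : 'I_n, (k <= b)%N -> x ord0 b = x0 ord0 b) -> Z x = 0.
  by move=> x xb; apply: (slice n) => // b; rewrite leqNgt ltn_ord.
elim: k x => [x xb h|k IH x xb xk].
  by rewrite (_ : x = x0) //; apply/rowP => b; exact: h.
have [kn|nk] := ltnP k n; last first.
  by apply: IH => // b kb; have := leq_ltn_trans kb (ltn_ord b); rewrite ltnNge nk.
pose c := Ordinal kn; pose T := x ord0 c - x0 ord0 c.
pose y : 'rV[R]_n := (- T) *: e c + x.
have Ttau : `|T| < tau by move/(ball_rowP _ _ tau0): xb => /(_ c); rewrite distrC.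
have yc : y ord0 c = x0 ord0 c by rewrite line_entry eqxx mulr1 /T opprB subrK.
have yb : ball x0 tau y.
  by apply: ball_line => //; rewrite /T opprB subrK subrr normr0.
have xE : T *: e c + y = x by rewrite addrA -scalerDl subrr scale0r add0r.
have y0 : Z y = 0.
  apply: IH => // b; rewrite leq_eqVlt => /orP[/eqP h|kb].
    by rewrite (_ : b = c) //; apply: val_inj.
  rewrite line_entry (_ : (b == c) = false) ?mulr0 ?add0r ?xk //.
  by apply/eqP => bc; rewrite bc /= ltnn in kb.
have lineb (t : R) : `|t| <= `|T| -> ball x0 tau (t *: e c + y).
  move=> tT; apply: ball_line => //.
  by rewrite yc opprD addrCA subrr addr0 normrN (le_lt_trans tT).
have := @gronwall R m p (fun t => Z (t *: e c + y)) (fun t => D c (t *: e c + y))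
  `|T| K 0 (normr_ge0 _).
have hd (t : R) : `|t| <= `|T| ->
    dmx t 1 (fun t => Z (t *: e c + y)) (D c (t *: e c + y)).
  by move=> tT; apply/dmx_line; apply: dZ; exact: lineb.
move=> /(_ hd) gr.
have /gr {}gr : forall t : R, `|t| <= `|T| ->
    sum_norm (D c (t *: e c + y)) <= K * sum_norm (Z (t *: e c + y)) + 0.
  by move=> t tT; rewrite addr0; apply: Dle; exact: lineb.
have /gr {}gr : (m * p)%:R * (`|T| * K) <= 2^-1.
  apply: le_trans small; rewrite ler_wpM2l // ler_wpM2r //; exact: ltW.
have := gr K0 T (lexx _).
rewrite scale0r add0r xE y0 sum_norm0 !mulr0 addr0 mulr0; exact: sum_norm_eq0.
Qed.

Lemma smooth_mx_locally_bounded (V : set 'rV[R]_n) m p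
    (F : 'rV[R]_n -> 'M[R]_(m, p)) (x0 : 'rV[R]_n) : smooth_mx V F -> V x0 ->
  exists K : R, \forall x \near x0, sum_norm (F x) <= K.
Proof.
move=> sF Vx0; exists (sum_norm (F x0) + 1).
have cF : {for x0, continuous (fun x => sum_norm (F x))}.
  by apply: sum_norm_continuous => i j; exact: (smooth_on_regular (sF i j) Vx0).1.
move/cvgrPdist_le: cF => /(_ 1 ltr01); apply: filterS => x.
by rewrite ler_norml => /andP[h _]; lra.
Qed.

End BallCalculus.

(** * Flat coordinates *)

Lemma smooth_on_subset (R : realType) (n : nat) (V W : set 'rV[R]_n) f :
  W `<=` V -> smooth_on V f -> smooth_on W f.
Proof. by move=> WV sf s x /WV; exact: sf. Qed.

Lemma near_uniform_bound (R : realType) (T : topologicalType) (I : finType)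
    (f : I -> T -> R) (x0 : T) :
  (forall i, exists K, \forall x \near x0, f i x <= K) ->
  exists K, \forall x \near x0, forall i, f i x <= K.
Proof.
move=> /choice[K fK]; exists (\sum_i `|K i|).
apply: (@near_forall T I x0 (fun i x => f i x <= \sum_i `|K i|)) => i.
apply: filterS (fK i) => x /le_trans; apply; apply: le_trans (ler_norm _) _.
by rewrite (bigD1 i) //= lerDl sumr_ge0.
Qed.

Lemma generated_sum (R : realType) n (S : ('rV[R]_n -> R) -> Prop) I (r : seq I)
    (F : I -> 'rV[R]_n -> R) : (forall i, generated S (F i)) ->
  generated S (fun x => \sum_(i <- r) F i x).
Proof.
move=> gF; elim: r => [|i r IH].
  by under eq_fun do rewrite big_nil; exact: generated_cst.
under eq_fun do rewrite big_cons.
by apply: generated_add; [exact: gF | exact: IH].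
Qed.

(* Bootstrap: every partial derivative of an entry of [Y] is a polynomial in
   smooth functions and the entries of [Y]. *)
Lemma linear_system_smooth (R : realType) n m p (W : set 'rV[R]_n)
    (A : 'I_n -> 'rV[R]_n -> 'M[R]_m) (Y : 'rV[R]_n -> 'M[R]_(m, p)) :
  open W -> (forall a, smooth_mx W (A a)) ->
  (forall x, W x -> forall a, dmx x (delta_mx ord0 a) Y (A a x *m Y x)) ->
  (forall x, W x -> forall i j, {for x, continuous (fun x => Y x i j)}) ->
  smooth_mx W Y.
Proof.
move=> openW sA dY cY i j.
pose S (h : 'rV[R]_n -> R) :=
  smooth_on W h \/ exists i j, h = (fun x => Y x i j).
apply: (@generated_smooth_on _ _ W openW S); last first.
- by apply: generated_gen; right; exists i, j.
- move=> h a [sh|[k [l ->]]].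
    exists (pd a h) => //; apply: generated_gen; left; exact: smooth_on_pd.
  exists (fun x => \sum_q A a x k q * Y x q l) => [|x Wx].
    apply: generated_sum => q; apply: generated_mul; apply: generated_gen.
      by left; exact: sA.
    by right; exists q, l.
  by have [_] := dY x Wx a k l; rewrite mxE.
move=> h [sh|[k [l ->]]]; first exact: smooth_on_regular.
by move=> x Wx; split; [exact: cY | move=> a; have [] := dY x Wx a k l].
Qed.

(** Turns a bound on the metric into a bound on the coframe, once [G = E E^T]. *)
Lemma sqr_entry_le_gram (R : realDomainType) m p (M : 'M[R]_(m, p)) i j :
  M i j ^+ 2 <= (M *m M^T) i i.
Proof.
rewrite mxE (bigD1 j) //= trmxE -expr2 lerDl.
by apply: sumr_ge0 => k _; rewrite trmxE -expr2 sqr_ge0.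
Qed.

Section FlatCoordinates.
Variables (R : realType) (n : nat) (V : set 'rV[R]_n) (G : 'rV[R]_n -> 'M[R]_n).
Hypothesis openV : open V.
Hypothesis smoothG : smooth_mx V G.
Hypothesis symG : forall x, V x -> (G x)^T = G x.
Hypothesis posG : forall x, V x -> forall v : 'rV[R]_n, v != 0 ->
  0 < (v *m G x *m v^T) ord0 ord0.
Hypothesis flatG : forall x, V x -> forall i j, curvature_mx G i j x = 0.
Local Notation e i := (delta_mx ord0 i : 'rV[R]_n).
Local Notation Gam := (connection G).

Let unitG := posdef_unitmx symG posG.

(* The linear system satisfied by a parallel coframe [E] together with a map
   [F] whose derivative is [E]. *)
Definition coframe_system (a : 'I_n) (x : 'rV[R]_n) : 'M[R]_(n + 1) :=
  block_mx (Gam a x) 0 (e a) 0.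

Lemma smooth_coframe_system a : smooth_mx V (coframe_system a).
Proof.
move=> i j; rewrite /coframe_system.
case: (split_ordP i) => i' ->; case: (split_ordP j) => j' ->.
- under eq_fun do rewrite block_mxEul; exact: (smooth_connection openV smoothG unitG).
- under eq_fun do rewrite block_mxEur mxE; exact: smooth_on_cst.
- under eq_fun do rewrite block_mxEdl; exact: smooth_on_cst.
- under eq_fun do rewrite block_mxEdr mxE; exact: smooth_on_cst.
Qed.

Lemma pdmx_coframe_system a c x : V x ->
  pdmx (coframe_system a) c x = block_mx (pdmx (Gam a) c x) 0 0 0.
Proof.
move=> Vx; apply: dmx_pdmx => i j; rewrite /coframe_system.
have dG : dmx x (e c) (Gam a) (pdmx (Gam a) c x).
  by apply: pdmx_dmx Vx; exact: (smooth_connection openV smoothG unitG).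
case: (split_ordP i) => i' ->; case: (split_ordP j) => j' ->.
- by rewrite block_mxEul; under eq_fun do rewrite block_mxEul; exact: dG.
- rewrite block_mxEur mxE; under eq_fun do rewrite block_mxEur mxE.
  exact: is_derive_cst.
- rewrite block_mxEdl mxE; under eq_fun do rewrite block_mxEdl.
  exact: is_derive_cst.
- rewrite block_mxEdr mxE; under eq_fun do rewrite block_mxEdr mxE.
  exact: is_derive_cst.
Qed.

Lemma coframe_block (P1 P2 B C : 'M[R]_n) (ea ec : 'rV[R]_n) :
  P1 + B *m C = P2 + C *m B -> ea *m C = ec *m B ->
  (block_mx P1 0 0 0 : 'M[R]_(n + 1)) + block_mx B 0 ea 0 *m block_mx C 0 ec 0 =
  block_mx P2 0 0 0 + block_mx C 0 ec 0 *m block_mx B 0 ea 0.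
Proof.
move=> E1 E2; rewrite !mulmx_block !add_block_mx !mul0mx !mulmx0 !addr0 !add0r.
by rewrite E1 E2.
Qed.

Lemma coframe_system_integrable a c x : V x ->
  pdmx (coframe_system a) c x + coframe_system a x *m coframe_system c x =
  pdmx (coframe_system c) a x + coframe_system c x *m coframe_system a x.
Proof.
move=> Vx; rewrite (pdmx_coframe_system a c Vx) (pdmx_coframe_system c a Vx).
(* The upper block is the vanishing of curvature; the lower one says that row a of Gamma_c is row c
   of Gamma_a. *)
apply: coframe_block; last first.
  apply/rowP => k; rewrite -!rowE [LHS]mxE [RHS]mxE.
  exact: (connection_sym openV symG).
have := flatG Vx c a; rewrite /curvature_mx.
move: (pdmx _ _ _) (pdmx _ _ _) (_ *m _) (_ *m _) => b1 b2 b3 b4 h.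
apply/eqP; rewrite -subr_eq0; apply/eqP; apply: etrans h.
by rewrite opprD addrA; congr (_ - _); rewrite addrAC.
Qed.

Lemma local_bounds m (A : 'I_n -> 'rV[R]_n -> 'M[R]_m) (x0 : 'rV[R]_n) :
  (forall a, smooth_mx V (A a)) -> V x0 ->
  exists rho K : R, [/\ 0 < rho, ball x0 rho `<=` V, 0 <= K &
    forall x, ball x0 rho x ->
      [/\ forall a, sum_norm (A a x) <= K,
          forall a c, sum_norm (pdmx (A c) a x) <= K,
          forall a c, sum_norm (pdmx (pdmx (A c) a) a x) <= K &
          sum_norm (G x) <= K]].
Proof.
move=> sA Vx0.
have sA1 a c : smooth_mx V (pdmx (A c) a) by exact: smooth_mx_pdmx.
have sA2 a c : smooth_mx V (pdmx (pdmx (A c) a) a) by exact: smooth_mx_pdmx.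
have [K0 h0] := @near_uniform_bound R _ 'I_n (fun a x => sum_norm (A a x)) x0
  (fun a => smooth_mx_locally_bounded (sA a) Vx0).
have [K1 h1] := @near_uniform_bound R _ ('I_n * 'I_n)%type
  (fun ac x => sum_norm (pdmx (A ac.2) ac.1 x)) x0
  (fun ac => smooth_mx_locally_bounded (sA1 ac.1 ac.2) Vx0).
have [K2 h2] := @near_uniform_bound R _ ('I_n * 'I_n)%type
  (fun ac x => sum_norm (pdmx (pdmx (A ac.2) ac.1) ac.1 x)) x0
  (fun ac => smooth_mx_locally_bounded (sA2 ac.1 ac.2) Vx0).
have [K3 h3] := smooth_mx_locally_bounded smoothG Vx0.
have hV := open_nbhs_nbhs (conj openV Vx0).
have : \forall x \near x0, V x /\
    ((forall a, sum_norm (A a x) <= K0) /\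
     (forall ac : 'I_n * 'I_n, sum_norm (pdmx (A ac.2) ac.1 x) <= K1)) /\
    (forall ac : 'I_n * 'I_n, sum_norm (pdmx (pdmx (A ac.2) ac.1) ac.1 x) <= K2) /\
    sum_norm (G x) <= K3.
  exact: filterI hV (filterI (filterI h0 h1) (filterI h2 h3)).
move=> /nbhs_ballP[rho /= rho0 hrho].
exists rho, (`|K0| + `|K1| + `|K2| + `|K3|); split=> [//|x /hrho[]//||].
  by rewrite !addr_ge0.
move=> x /hrho[_ [[/= b0 b1] [/= b2 b3]]].
have := ler_norm K0; have := ler_norm K1; have := ler_norm K2; have := ler_norm K3.
have := normr_ge0 K0; have := normr_ge0 K1; have := normr_ge0 K2; have := normr_ge0 K3.
move=> n3 n2 n1 n0 l3 l2 l1 l0; split=> [a|a c|a c|].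
- by have := b0 a; move: (sum_norm _) => q hq; lra.
- by have := b1 (a, c); move: (sum_norm _) => q hq; lra.
- by have := b2 (a, c); move: (sum_norm _) => q hq; lra.
- by move: b3; move: (sum_norm _) => q hq; lra.
Qed.

Lemma flat_coframe (x0 : 'rV[R]_n) : V x0 ->
  exists (r : R) (E : 'rV[R]_n -> 'M[R]_n) (F : 'rV[R]_n -> 'rV[R]_n),
    [/\ 0 < r, ball x0 r `<=` V, smooth_mx (ball x0 r) E, smooth_mx (ball x0 r) F &
        forall x, ball x0 r x -> G x = E x *m (E x)^T /\
          forall a, dmx x (e a) F (e a *m E x)].
Proof.
move=> Vx0.
have [L uL GL] := cholesky (symG Vx0) (posG Vx0).
pose A := coframe_system.
have sA a : smooth_mx V (A a) by exact: smooth_coframe_system.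
have [rho [K [rho0 rhoV K0 bnd]]] := local_bounds sA Vx0.
pose KG := (n * n)%:R * K; have KG0 : 0 <= KG by rewrite mulr_ge0.
(* The sum of the constants required by [frobenius] and by [zero_of_linear_bound], so that one [tau]
   serves both. *)
pose N := ((n + 1) * n)%:R * K + (n * n)%:R * (2 * KG).
have N0 : 0 <= N by rewrite addr_ge0 // !mulr_ge0.
pose tau := Num.min (rho / 2) (2^-1 / (N + 1)).
have tau0 : 0 < tau by rewrite lt_min !divr_gt0 // ltr_wpDl.
have tau_rho : tau < rho.
  by apply: (@le_lt_trans _ _ (rho / 2)); [rewrite ge_min lexx | lra].
have tauN : tau * N <= 2^-1.
  apply: (@le_trans _ _ (2^-1 / (N + 1) * (N + 1))); last by rewrite divfK // gt_eqF // ltr_wpDl.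
  by apply: ler_pM; rewrite ?(ltW tau0) ?lerDl // ge_min lexx orbT.
have small1 : ((n + 1) * n)%:R * (tau * K) <= 2^-1.
  apply: le_trans tauN; rewrite mulrCA ler_wpM2l ?(ltW tau0) // /N lerDl.
  by rewrite !mulr_ge0.
have small2 : (n * n)%:R * (tau * (2 * KG)) <= 2^-1.
  apply: le_trans tauN; rewrite mulrCA ler_wpM2l ?(ltW tau0) // /N lerDr.
  by rewrite mulr_ge0.
have subrho x : ball x0 tau x -> ball x0 rho x by apply: le_ball; exact: ltW.
have subV x : ball x0 tau x -> V x by move=> /subrho/rhoV.
(* The initial value makes E the Cholesky factor of [G] at [x0], where E E^T = G then holds, and
   puts F at the origin. *)
have [|||||Y [Y0 dY]] := @frobenius R n (n + 1) n x0 A rho tau K tau0 tau_rho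
  _ _ _ _ small1 _ (col_mx L 0).
- by move=> a i j; apply: (smooth_on_subset rhoV); exact: sA.
- by move=> a x /bnd[].
- by move=> a c x /bnd[].
- by move=> a c x /bnd[].
- move=> a c x /rhoV Vx.
  exact: coframe_system_integrable.
pose E x := usubmx (Y x); pose F x := dsubmx (Y x).
have AY a x : A a x *m Y x = col_mx (Gam a x *m E x) (e a *m E x).
  by rewrite -[Y x]vsubmxK /A /coframe_system mul_block_col !mul0mx !addr0.
have dE x : ball x0 tau x -> forall a, dmx x (e a) E (Gam a x *m E x).
  move=> xb a i j; have := dY x xb a (lshift 1 i) j; rewrite AY col_mxEu.
  by congr is_derive; apply/funext => y; rewrite mxE.
have dF x : ball x0 tau x -> forall a, dmx x (e a) F (e a *m E x).
  move=> xb a i j; have := dY x xb a (rshift n i) j; rewrite AY col_mxEd.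
  by congr is_derive; apply/funext => y; rewrite mxE.
have Gam_le a x : ball x0 tau x -> sum_norm (Gam a x) <= KG.
  move=> /subrho/bnd[/(_ a) h _ _ _]; apply: sum_norm_le => i j.
  apply: le_trans h; have := sum_norm_entry (A a x) (lshift 1 i) (lshift 1 j).
  by rewrite /A /coframe_system block_mxEul.
have GE x : ball x0 tau x -> G x = E x *m (E x)^T.
  move=> xb; apply/eqP; rewrite -subr_eq0; apply/eqP; move: x xb.
  (* Z = G - E E^T has a-derivative Gamma_a Z + Z Gamma_a^T, whence the bound [2 * KG]. *)
  apply: (@zero_of_linear_bound R n n n (fun x => G x - E x *m (E x)^T)
    (fun a x => Gam a x *m (G x - E x *m (E x)^T)
      + (G x - E x *m (E x)^T) *m (Gam a x)^T) x0 tau (2 * KG) tau0 _ small2).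
  - by rewrite mulr_ge0.
  - move=> x xb a; have Vx := subV x xb.
    have dG : dmx x (e a) G (pdmx G a x) by exact: pdmx_dmx smoothG Vx.
    rewrite (metric_compatible openV symG unitG a Vx) in dG.
    have := dmxD dG (dmxN (dmxM (dE x xb a) (dmxT (dE x xb a)))).
    congr dmx; rewrite mulmxBr mulmxBl trmx_mul !mulmxA opprD.
    by rewrite addrACA.
  - move=> x xb a; apply: le_trans (sum_normD _ _) _.
    set Z := G x - _; have := sum_normM (Gam a x) Z; have := sum_normM Z (Gam a x)^T.
    rewrite sum_normT; have := ler_wpM2r (sum_norm_ge0 Z) (Gam_le a x xb).
    rewrite [sum_norm Z * _]mulrC.
    move: (sum_norm _) (sum_norm _) (_ * _) => p q s h1 h2 h3.
    by rewrite -mulrA; move: (KG * _) h1 => t h1; lra.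
  - by rewrite /E Y0 col_mxKu -GL subrr.
(* Squares of entries of E are at most diagonal entries of G, hence at most [K]; then t <= 1 + t^2
   bounds the entries themselves. *)
pose KE := (n * n)%:R * (1 + K).
have E_le x : ball x0 tau x -> sum_norm (E x) <= KE.
  move=> xb; apply: sum_norm_le => i j.
  have [_ _ _ GK] := bnd x (subrho x xb).
  have := le_trans (ler_norm _) (le_trans (sum_norm_entry (G x) i i) GK).
  rewrite GE // => h; have h2 := sqr_entry_le_gram (E x) i j.
  have h3 : `|E x i j| <= 1 + E x i j ^+ 2.
    by rewrite -real_normK ?num_real //; move: (`|_|) => t; nra.
  by lra.
have KE0 : 0 <= KE by exact: le_trans (sum_norm_ge0 _) (E_le x0 (ballxx x0 tau0)).
(* The input that [linear_system_smooth] requires: its bootstrap starts from continuity, obtained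
   here from bounded partial derivatives. *)
have cY x : ball x0 tau x -> forall i j, {for x, continuous (fun x => Y x i j)}.
  move=> xb i j.
  have : \forall z \near x, ball x0 tau z.
    apply: open_nbhs_nbhs; split; [exact: ball_open | exact: xb].
  move=> /nbhs_ballP[d /= d0 dsub].
  apply: (@bounded_partials_continuous R n (fun x => Y x i j)
    (fun a x => (A a x *m Y x) i j) x d (KG * KE + KE) d0).
    by move=> z /dsub zb a; exact: dY.
  move=> z /dsub zb a; rewrite AY; case: (split_ordP i) => i' ->.
    rewrite col_mxEu; apply: le_trans (sum_norm_entry _ _ _) _.
    apply: le_trans (sum_normM _ _) _.
    apply: (@le_trans _ _ (KG * KE)); last by rewrite lerDl.
    by apply: ler_pM; rewrite ?sum_norm_ge0 ?Gam_le ?E_le.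
  rewrite col_mxEd -rowE mxE.
  apply: le_trans (sum_norm_entry _ _ _) (le_trans (E_le z zb) _).
  by rewrite lerDr mulr_ge0.
have sY : smooth_mx (ball x0 tau) Y.
  apply: (@linear_system_smooth R n _ _ _ A) => //; first exact: ball_open.
  by move=> a i j; apply: (smooth_on_subset subV); exact: sA.
exists tau, E, F; split => //.
- by move=> i j; have := sY (lshift 1 i) j; congr smooth_on; apply/funext => y; rewrite mxE.
- by move=> i j; have := sY (rshift n i) j; congr smooth_on; apply/funext => y; rewrite mxE.
- by move=> x xb; split; [exact: GE | exact: dF].
Qed.

End FlatCoordinates.

(** Injectivity is half of the inverse function theorem. If F x = F y, then v = y - x satisfies v M
    = 0 for a matrix M of intermediate values of E, so v = v (E x0 - M) (E x0)^-1, which is at most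
    half of v in norm. *)
Lemma flat_chart (R : realType) (n : nat) (V : set 'rV[R]_n)
    (G : 'rV[R]_n -> 'M[R]_n) (x0 : 'rV[R]_n) :
  open V -> smooth_mx V G -> (forall x, V x -> (G x)^T = G x) ->
  (forall x, V x -> forall v : 'rV[R]_n, v != 0 ->
    0 < (v *m G x *m v^T) ord0 ord0) ->
  (forall x, V x -> forall i j, curvature_mx G i j x = 0) -> V x0 ->
  exists (W : set 'rV[R]_n) (F : 'rV[R]_n -> 'rV[R]_n),
    [/\ [/\ open W, W x0 & W `<=` V], smooth_map_on W F, set_inj W F &
        forall x, W x -> G x = Defs.jacobian F x *m (Defs.jacobian F x)^T].
Proof.
move=> openV smoothG symG posG flatG Vx0.
have [r [E [F [r0 rV sE sF EF]]]] := flat_coframe openV smoothG symG posG flatG Vx0.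
have x0r := ballxx x0 r0.
have uE : E x0 \in unitmx.
  have := posdef_unitmx symG posG Vx0; have [-> _] := EF x0 x0r.
  by rewrite unitmx_mul => /andP[].
(* Chosen so that n^2 eps times the norm of (E x0)^-1 is at most eps c = 1/2. *)
pose c := (n * n)%:R * sum_norm (invmx (E x0)) + 1.
have c0 : 0 < c by rewrite ltr_wpDl // mulr_ge0 // sum_norm_ge0.
pose eps := 2^-1 / c; have eps0 : 0 < eps by rewrite divr_gt0.
have near_E : \forall x \near x0, forall i j, `|E x0 i j - E x i j| <= eps.
  apply: (@near_forall _ 'I_n x0 (fun i x => forall j, `|E x0 i j - E x i j| <= eps)) => i.
  apply: (@near_forall _ 'I_n x0 (fun j x => `|E x0 i j - E x i j| <= eps)) => j.
  have /cvgrPdist_le := (smooth_on_regular (sE i j) x0r).1.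
  by move=> /(_ _ eps0).
have : \forall x \near x0, ball x0 r x /\ forall i j, `|E x0 i j - E x i j| <= eps.
  by apply: filterI near_E; apply: open_nbhs_nbhs; split; [exact: ball_open|].
move=> /nbhs_ballP[d /= d0 hd].
have d3 : 0 < d / 3 by rewrite divr_gt0.
have Wd x : ball x0 (d / 3) x -> ball x0 d x by apply: le_ball; lra.
have Wr x : ball x0 (d / 3) x -> ball x0 r x by move=> /Wd/hd[].
have dF x : ball x0 r x -> forall a b,
    is_derive x (delta_mx ord0 a) (fun x => F x ord0 b) (E x a b).
  by move=> xr a b; have [_ /(_ a ord0 b)] := EF x xr; rewrite -rowE mxE.
exists (ball x0 (d / 3)), F; split.
- by split; [exact: ball_open | exact: ballxx | move=> x /Wr/rV].
- by move=> b; apply: (smooth_on_subset Wr); exact: sF.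
- move=> x y; rewrite !inE => xW yW Fxy.
  pose v := y - x.
  have tele b : exists xi : 'I_n -> 'rV[R]_n,
      (forall a, ball x0 d (xi a)) /\ \sum_a v ord0 a * E (xi a) a b = 0.
    have [z zb|xi [xib xiE]] := @telescoping_mean_value R n (fun x => F x ord0 b)
      (fun a x => E x a b) x y.
      by move=> a; apply: dF; have [] := hd z (ball_between d0 xW yW zb).
    exists xi; split=> [a|]; first exact: ball_between d0 xW yW (xib a).
    transitivity (F y ord0 b - F x ord0 b); last by rewrite Fxy subrr.
    by rewrite [RHS]xiE; apply: eq_bigr => a _; rewrite !mxE.
  have [xi xiP] := choice tele.
  (* Each entry has its own intermediate point, so M is not a value of E; it is close to [E x0]
     entry by entry. *)
  pose M : 'M[R]_n := \matrix_(a, b) E (xi b a) a b.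
  have vM : v *m M = 0.
    apply/rowP => b; rewrite mxE [RHS]mxE; have [_ xi0] := xiP b.
    by apply: etrans xi0; apply: eq_bigr => a _; rewrite [M a b]mxE.
  have ME : sum_norm (E x0 - M) <= (n * n)%:R * eps.
    apply: sum_norm_le => a b; rewrite addmxE oppmxE [M a b]mxE.
    by have [/(_ a)/hd[_ h] _] := xiP b; exact: h.
  have vE : v = v *m (E x0 - M) *m invmx (E x0).
    by rewrite mulmxBr vM subr0 mulmxK.
  have v_le : sum_norm v <= sum_norm v * 2^-1.
    rewrite {1}vE -mulmxA; apply: le_trans (sum_normM _ _) _.
    rewrite ler_wpM2l ?sum_norm_ge0 //; apply: le_trans (sum_normM _ _) _.
    apply: (@le_trans _ _ ((n * n)%:R * eps * sum_norm (invmx (E x0)))).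
      by rewrite ler_wpM2r ?sum_norm_ge0.
    apply: (@le_trans _ _ (eps * c)); last by rewrite divfK // gt_eqF.
    rewrite mulrAC mulrC ler_wpM2l ?(ltW eps0) // /c.
    by rewrite lerDl.
  have : v = 0 by apply: sum_norm_eq0; move: v_le; move: (sum_norm _) => t; lra.
  by move=> /eqP; rewrite subr_eq0 => /eqP ->.
- move=> x /Wr xr; have [-> _] := EF x xr.
  suff -> : Defs.jacobian F x = E x by [].
  apply/matrixP => a b; rewrite /Defs.jacobian mxE.
  by have [_ h] := dF x xr a b; exact: h.
Qed.

Theorem theorem1p3 (R : realType) (n : nat) (M : ptopologicalType)
    (A : manifold R n M) (g : metric A)
    (vol : {measure set (borel M) -> \bar R}) (Q : R) :
  (3 <= n)%N ->
  connected [set: M] ->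
  ~ compact [set: M] ->
  complete_metric g ->
  riemannian_measure g vol ->
  ricci_flat g ->
  curvature_m_nonneg g ((n - 1) %/ 2)%N ->
  1 < Q ->
  abs_Rm g \in Lfun vol Q%:E ->
  Rm_zero g /\ flat g.
Proof.
move=> n3 _ _ _ _ ric0 nonneg _ _.
pose V (i : chart A) := phi i @` dom i.
have openV i : open (V i) by exact: codom_open.
have smoothG i : smooth_mx (V i) (gm g i) by exact: gm_smooth.
have symG i x : V i x -> (gm g i x)^T = gm g i x by move=> [p pd <-]; exact: gm_sym.
have posG i x : V i x -> forall v : 'rV[R]_n, v != 0 ->
    0 < (v *m gm g i x *m v^T) ord0 ord0.
  by move=> [p pd <-] v; exact: gm_pos.
have half_gt0 : (0 < (n - 1) %/ 2)%N by rewrite divn_gt0 // ltn_subRL.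
have half_lt : (0 < (n - 1) %/ 2 < #|bivec n|)%N.
  by rewrite half_gt0; exact: card_bivec_gt.
have Rm0 : Rm_zero g.
  move=> i p pd a b c d; have [mu ev mu0] := nonneg i p pd.
  apply: (ricci_flat_nonneg_Rm_eq0 (openV i) (smoothG i) (symG i) (posG i) _ _
    half_lt ev mu0); first by exists p.
  by move=> j k; exact: ric0.
split=> // p; pose i := chart_at A p; have pi := chart_atP A p.
have Vp : V i (phi i p) by exists p.
have flatG x : V i x -> forall j k, curvature_mx (gm g i) j k x = 0.
  move=> Vx j k; have uG := posdef_unitmx (symG i) (posG i) Vx.
  (* [Rm] carries a lowered index: its vanishing gives the curvature times the metric, and the
     metric is invertible. *)
  have RG : curvature_mx (gm g i) j k x *m gm g i x = 0.
    apply/matrixP => l m; rewrite -Rm_curvature_mx mxE.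
    by case: Vx => q qd <-; exact: Rm0.
  by rewrite -[LHS](mulmxK uG) RG mul0mx.
have [W [F [hW sF injF GF]]] :=
  flat_chart (openV i) (smoothG i) (symG i) (posG i) flatG Vp.
by exists i, W, F; split.
Qed.
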